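(* Let $R$ be a Noetherian ring, $X=\mathrm{Spec}(R)$, and let $\mathcal{M}\subset\mathcal{N}$ be finitely generated $R$-modules. There exists $n_0$ such that $$\mathrm{Ass}_X(\mathcal{N}^{n_0}/\mathcal{M}^{n_0})=\mathrm{Ass}_X(\mathcal{N}^{n_0+k}/\mathcal{M}^{n_0+k})$$ for any $k\geq 0$.
   Context: Rees algebra: for a finitely generated $R$-module $\mathcal{M}$, $\mathcal{R}(\mathcal{M}):=\mathrm{Sym}(\mathcal{M})/\bigcap_g\mathcal{L}_g$, where $g$ runs over all homomorphisms from $\mathcal{M}$ to a free $R$-module $\mathcal{F}_g$ and $\mathcal{L}_g$ is the kernel of $\mathrm{Sym}(\mathcal{M})\to\mathrm{Sym}(\mathcal{F}_g)$. The inclusion $\mathcal{M}\subset\mathcal{N}$ induces $\mathcal{R}(\mathcal{M})\to\mathcal{R}(\mathcal{N})$. For $n\ge1$, $\mathcal{N}^n$ is the $n$th graded component of $\mathcal{R}(\mathcal{N})$ and $\mathcal{M}^n$ is the image in $\mathcal{R}(\mathcal{N})$ of the $n$th graded component of $\mathcal{R}(\mathcal{M})$. $\mathrm{Ass}_X(L)$ is the set of points of $X$ whose prime ideals are associated primes of the $R$-module $L$. *)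

(* Defs.v *)
From HB Require Import structures.
From mathcomp Require Import all_boot all_algebra.
From mathcomp Require Import boolp classical_sets.

Set Implicit Arguments.
Unset Strict Implicit.
Unset Printing Implicit Defensive.

Import GRing.Theory.
Local Open Scope ring_scope.
Local Open Scope quotient_scope.

(* Rings are [comPzRingType], so that the zero ring is allowed; this is also
   why the ring quotients of [ring_quotient] and the (nonzero) algebras of
   [ssralg] are not used below.  Here an R-algebra is a commutative ring with
   a ring morphism from R. *)

Record submodule (R : comPzRingType) (V : lmodType R) := Submodule {
  submod_pred :> {pred V};
  submod_predP : submod_closed submod_pred
}.

HB.instance Definition _ (R : comPzRingType) (V : lmodType R)
    (W : submodule V) :=
  GRing.isSubmodClosed.Build R V (submod_pred W) (submod_predP W).

Section Submodules.
Variable R : comPzRingType.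

Section SubAndQuotient.
Variables (V : lmodType R) (W : submodule V).

Inductive submod_type := SubmodElt (x : V) of x \in W.
Definition submod_val (u : submod_type) : V := let: SubmodElt x _ := u in x.

HB.instance Definition _ := [isSub for submod_val].
HB.instance Definition _ := [Choice of submod_type by <:].
HB.instance Definition _ := [SubChoice_isSubLmodule of submod_type by <:].

Fact submod_val_linear : linear submod_val.
Proof. by move=> a x y; exact: (linearP (val : submod_type -> V)). Qed.
HB.instance Definition _ :=
  GRing.isLinear.Build R submod_type V *:%R submod_val submod_val_linear.

Definition quotmod := Quotient.quot (submod_pred W).
HB.instance Definition _ := GRing.Zmodule.on quotmod.
HB.instance Definition _ := EqQuotient.on quotmod.

Definition quotmod_pi (x : V) : quotmod := \pi_quotmod x.

Lemma quotmod_piK (x : quotmod) : quotmod_pi (repr x) = x.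
Proof. exact: reprK. Qed.

Lemma quotmod_eqP x y : (quotmod_pi x = quotmod_pi y) <-> (x - y \in W).
Proof.
rewrite /quotmod_pi; split=> [/eqP|h]; first by rewrite piE.
by apply/eqP; rewrite piE.
Qed.

Lemma quotmod_piB : zmod_morphism quotmod_pi.
Proof. by move=> x y; rewrite /quotmod_pi !piE. Qed.

HB.instance Definition _ :=
  GRing.isZmodMorphism.Build V quotmod quotmod_pi quotmod_piB.

Definition quotmod_scale (a : R) (x : quotmod) := quotmod_pi (a *: repr x).

Lemma quotmod_scaleE a x : quotmod_scale a (quotmod_pi x) = quotmod_pi (a *: x).
Proof.
by apply/quotmod_eqP; rewrite -scalerBr rpredZ //; apply/quotmod_eqP;
   rewrite quotmod_piK.
Qed.

Fact quotmod_scaleA a b x :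
  quotmod_scale a (quotmod_scale b x) = quotmod_scale (a * b) x.
Proof. by rewrite -[x]quotmod_piK !quotmod_scaleE scalerA. Qed.
Fact quotmod_scale1 : left_id 1 quotmod_scale.
Proof. by move=> x; rewrite -[x]quotmod_piK quotmod_scaleE scale1r. Qed.
Fact quotmod_scaleDr : right_distributive quotmod_scale +%R.
Proof.
move=> a x y; rewrite -[x]quotmod_piK -[y]quotmod_piK -raddfD !quotmod_scaleE.
by rewrite scalerDr raddfD.
Qed.
Fact quotmod_scaleDl x : {morph quotmod_scale^~ x : a b / a + b}.
Proof.
by move=> a b; rewrite -[x]quotmod_piK !quotmod_scaleE scalerDl raddfD.
Qed.

HB.instance Definition _ := GRing.Zmodule_isLmodule.Build R quotmod
  quotmod_scaleA quotmod_scale1 quotmod_scaleDr quotmod_scaleDl.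

Fact quotmod_pi_scalable : scalable quotmod_pi.
Proof. by move=> a x; rewrite -quotmod_scaleE. Qed.

HB.instance Definition _ :=
  GRing.isScalable.Build R V quotmod *:%R quotmod_pi quotmod_pi_scalable.

End SubAndQuotient.

Section Images.
Variables (U V : lmodType R) (f : {linear U -> V}).

Fact submod_image_subproof (W : submodule U) :
  submod_closed [pred y : V | `[< exists2 x, x \in W & f x = y >]].
Proof.
split=> [|a y z]; rewrite !inE.
  by exists 0; [exact: rpred0 | exact: raddf0].
move=> [u uW <-] [v vW <-].
by exists (a *: u + v); [rewrite rpredD ?rpredZ | rewrite linearP].
Qed.
Definition submod_image W := Submodule (submod_image_subproof W).

Fact submod_preimage_subproof (W : submodule V) :
  submod_closed [pred x : U | f x \in W].
Proof.
split=> [|a x y]; rewrite !inE ?raddf0 ?rpred0 // => fx fy.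
by rewrite linearP rpredD ?rpredZ.
Qed.
Definition submod_preimage W := Submodule (submod_preimage_subproof W).

End Images.

(* A / (A :&: B), which is A / B when B is contained in A. *)
Definition subquotient (V : lmodType R) (A B : submodule V) : lmodType R :=
  quotmod (submod_preimage (@submod_val V A) B).

End Submodules.

Section CommutativeAlgebra.
Variable R : comPzRingType.

Definition finitely_generated (V : lmodType R) : Prop :=
  exists s : seq V, forall x : V,
    exists c : nat -> R, x = \sum_(i < size s) c i *: s`_i.

(* Ideals of R are the submodules of the regular module [R^o]. *)
Definition noetherian : Prop :=
  forall I : submodule R^o, finitely_generated (submod_type I).

Definition basis (V : lmodType R) (B : set V) : Prop :=
  (forall (s : seq V) (c : V -> R), uniq s -> (forall b, b \in s -> B b) ->
     \sum_(b <- s) c b *: b = 0 -> forall b, b \in s -> c b = 0) /\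
  (forall x : V, exists (s : seq V) (c : V -> R),
     (forall b, b \in s -> B b) /\ x = \sum_(b <- s) c b *: b).

(* Possibly of infinite rank. *)
Definition free_module (V : lmodType R) : Prop := exists B : set V, basis B.

Record Spec := PrimeIdeal {
  prime_ideal :> submodule R^o;
  prime_ideal_proper : (1 : R) \notin prime_ideal;
  prime_idealM : forall x y : R,
    x * y \in prime_ideal -> (x \in prime_ideal) || (y \in prime_ideal)
}.

Definition Ass (L : lmodType R) : set Spec :=
  [set p : Spec | exists x : L, forall r : R, r \in p <-> r *: x = 0].

End CommutativeAlgebra.

(* The commutative R-algebra generated by the elements of M, subject to the
   R-linearity of M -> Sym(M): polynomial expressions in the elements of M,
   modulo the least congruence [sym_rel] for which this is an R-algebra with
   [SymGen] linear.  Its universal property is given by [sym_lift_const],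
   [sym_lift_inj], [sym_liftD], [sym_liftM] and [sym_lift_unique]. *)
Section SymmetricAlgebra.
Variables (R : comPzRingType) (M : lmodType R).

Inductive sym_expr :=
  | SymConst of R
  | SymGen of M
  | SymAdd of sym_expr & sym_expr
  | SymMul of sym_expr & sym_expr.

Inductive sym_rel : sym_expr -> sym_expr -> Prop :=
  | SymRefl x : sym_rel x x
  | SymSym x y : sym_rel x y -> sym_rel y x
  | SymTrans x y z : sym_rel x y -> sym_rel y z -> sym_rel x z
  | SymAddCong x x' y y' :
      sym_rel x x' -> sym_rel y y' -> sym_rel (SymAdd x y) (SymAdd x' y')
  | SymMulCong x x' y y' :
      sym_rel x x' -> sym_rel y y' -> sym_rel (SymMul x y) (SymMul x' y')
  | SymAddA x y z :
      sym_rel (SymAdd x (SymAdd y z)) (SymAdd (SymAdd x y) z)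
  | SymAddC x y : sym_rel (SymAdd x y) (SymAdd y x)
  | SymAdd0 x : sym_rel (SymAdd (SymConst 0) x) x
  | SymAddN x :
      sym_rel (SymAdd (SymMul (SymConst (- 1)) x) x) (SymConst 0)
  | SymMulA x y z :
      sym_rel (SymMul x (SymMul y z)) (SymMul (SymMul x y) z)
  | SymMulC x y : sym_rel (SymMul x y) (SymMul y x)
  | SymMul1 x : sym_rel (SymMul (SymConst 1) x) x
  | SymMulD x y z :
      sym_rel (SymMul (SymAdd x y) z) (SymAdd (SymMul x z) (SymMul y z))
  | SymConstD a b :
      sym_rel (SymConst (a + b)) (SymAdd (SymConst a) (SymConst b))
  | SymConstM a b :
      sym_rel (SymConst (a * b)) (SymMul (SymConst a) (SymConst b))
  | SymGenD u v : sym_rel (SymGen (u + v)) (SymAdd (SymGen u) (SymGen v))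
  | SymGenZ a u : sym_rel (SymGen (a *: u)) (SymMul (SymConst a) (SymGen u)).

HB.instance Definition _ := gen_eqMixin sym_expr.
HB.instance Definition _ := gen_choiceMixin sym_expr.

Definition sym_relb : rel sym_expr := fun x y => `[< sym_rel x y >].

Fact sym_relb_equiv : equiv_class_of sym_relb.
Proof.
split=> [x|x y|y x z].
- exact/asboolP/SymRefl.
- by apply/asboolP/asboolP; exact: SymSym.
- by move=> /asboolP xy /asboolP yz; apply/asboolP; exact: SymTrans yz.
Qed.

Canonical sym_relb_rel := EquivRelPack sym_relb_equiv.
Canonical sym_relb_enc := defaultEncModRel sym_relb.

Definition Sym := {eq_quot sym_relb}.
HB.instance Definition _ := Choice.on Sym.
HB.instance Definition _ := EqQuotient.on Sym.

Definition sym_class (x : sym_expr) : Sym := \pi_Sym x.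

Lemma sym_classK (x : Sym) : sym_class (repr x) = x.
Proof. exact: reprK. Qed.

Lemma sym_classP x y : sym_class x = sym_class y <-> sym_rel x y.
Proof.
rewrite /sym_class; split=> [/eqP|h].
  by rewrite piE => /asboolP.
by apply/eqP; rewrite piE; exact/asboolP.
Qed.

Lemma sym_reprP x : sym_rel (repr (sym_class x)) x.
Proof. by apply/sym_classP; rewrite sym_classK. Qed.

Definition sym_add (x y : Sym) := sym_class (SymAdd (repr x) (repr y)).
Definition sym_mul (x y : Sym) := sym_class (SymMul (repr x) (repr y)).
Definition sym_opp (x : Sym) := sym_mul (sym_class (SymConst (- 1))) x.

Lemma sym_addE x y :
  sym_add (sym_class x) (sym_class y) = sym_class (SymAdd x y).
Proof. by apply/sym_classP/SymAddCong; exact: sym_reprP. Qed.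
Lemma sym_mulE x y :
  sym_mul (sym_class x) (sym_class y) = sym_class (SymMul x y).
Proof. by apply/sym_classP/SymMulCong; exact: sym_reprP. Qed.

Fact sym_addA : associative sym_add.
Proof.
move=> x y z; rewrite -[x]sym_classK -[y]sym_classK -[z]sym_classK !sym_addE.
exact/sym_classP/SymAddA.
Qed.
Fact sym_addC : commutative sym_add.
Proof. by move=> x y; exact/sym_classP/SymAddC. Qed.
Fact sym_add0 : left_id (sym_class (SymConst 0)) sym_add.
Proof.
by move=> x; rewrite -[x]sym_classK sym_addE; exact/sym_classP/SymAdd0.
Qed.
Fact sym_addN : left_inverse (sym_class (SymConst 0)) sym_opp sym_add.
Proof.
move=> x; rewrite -[x]sym_classK /sym_opp sym_mulE sym_addE.
exact/sym_classP/SymAddN.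
Qed.

HB.instance Definition _ :=
  GRing.isZmodule.Build Sym sym_addA sym_addC sym_add0 sym_addN.

Lemma sym_addrE x y : sym_class x + sym_class y = sym_class (SymAdd x y).
Proof. exact: sym_addE. Qed.

Fact sym_mulA : associative sym_mul.
Proof.
move=> x y z; rewrite -[x]sym_classK -[y]sym_classK -[z]sym_classK !sym_mulE.
exact/sym_classP/SymMulA.
Qed.
Fact sym_mulC : commutative sym_mul.
Proof. by move=> x y; exact/sym_classP/SymMulC. Qed.
Fact sym_mul1 : left_id (sym_class (SymConst 1)) sym_mul.
Proof.
by move=> x; rewrite -[x]sym_classK sym_mulE; exact/sym_classP/SymMul1.
Qed.
Fact sym_mulDl : left_distributive sym_mul +%R.
Proof.
move=> x y z; rewrite -[x]sym_classK -[y]sym_classK -[z]sym_classK.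
rewrite sym_addrE !sym_mulE sym_addrE.
exact/sym_classP/SymMulD.
Qed.

HB.instance Definition _ := GRing.Zmodule_isComPzRing.Build Sym
  sym_mulA sym_mulC sym_mul1 sym_mulDl.

Lemma sym_mulrE x y : sym_class x * sym_class y = sym_class (SymMul x y).
Proof. exact: sym_mulE. Qed.

Definition sym_const (a : R) : Sym := sym_class (SymConst a).

Fact sym_constD : {morph sym_const : a b / a + b}.
Proof. by move=> a b; rewrite sym_addrE; exact/sym_classP/SymConstD. Qed.
Fact sym_const_zmod : zmod_morphism sym_const.
Proof. by move=> a b; apply: (addIr (sym_const b)); rewrite -sym_constD !subrK. Qed.
Fact sym_const_monoid : monoid_morphism sym_const.
Proof.
by split=> // a b; rewrite sym_mulrE; exact/sym_classP/SymConstM.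
Qed.

HB.instance Definition _ :=
  GRing.isZmodMorphism.Build R Sym sym_const sym_const_zmod.
HB.instance Definition _ :=
  GRing.isMonoidMorphism.Build R Sym sym_const sym_const_monoid.

Definition sym_scale (a : R) (x : Sym) : Sym := sym_const a * x.

Fact sym_scaleA a b x : sym_scale a (sym_scale b x) = sym_scale (a * b) x.
Proof. by rewrite /sym_scale mulrA rmorphM. Qed.
Fact sym_scale1 : left_id 1 sym_scale.
Proof. by move=> x; rewrite /sym_scale rmorph1 mul1r. Qed.
Fact sym_scaleDr : right_distributive sym_scale +%R.
Proof. by move=> a x y; exact: mulrDr. Qed.
Fact sym_scaleDl x : {morph sym_scale^~ x : a b / a + b}.
Proof. by move=> a b; rewrite /sym_scale rmorphD mulrDl. Qed.

HB.instance Definition _ := GRing.Zmodule_isLmodule.Build R Sym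
  sym_scaleA sym_scale1 sym_scaleDr sym_scaleDl.

Lemma sym_scaleE a (x : Sym) : a *: x = sym_const a * x.
Proof. by []. Qed.

Definition sym_inj (u : M) : Sym := sym_class (SymGen u).

Fact sym_inj_linear : linear sym_inj.
Proof.
move=> a u v; rewrite sym_scaleE sym_mulrE sym_addrE.
apply/sym_classP/(SymTrans (SymGenD _ _))/SymAddCong; last exact: SymRefl.
exact: SymGenZ.
Qed.

HB.instance Definition _ :=
  GRing.isLinear.Build R M Sym *:%R sym_inj sym_inj_linear.

Section Lift.
Variables (S : comPzRingType) (phi : {rmorphism R -> S}) (f : M -> S).
Hypothesis fD : {morph f : u v / u + v}.
Hypothesis fZ : forall a u, f (a *: u) = phi a * f u.

Fixpoint sym_eval (x : sym_expr) : S :=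
  match x with
  | SymConst a => phi a
  | SymGen u => f u
  | SymAdd x y => sym_eval x + sym_eval y
  | SymMul x y => sym_eval x * sym_eval y
  end.

Lemma sym_eval_rel x y : sym_rel x y -> sym_eval x = sym_eval y.
Proof.
elim=> //=.
- by move=> ? ? ? _ -> _ ->.
- by move=> ? ? ? ? _ -> _ ->.
- by move=> ? ? ? ? _ -> _ ->.
- by move=> *; exact: addrA.
- by move=> *; exact: addrC.
- by move=> *; rewrite rmorph0 add0r.
- by move=> *; rewrite rmorphN rmorph1 rmorph0 mulN1r addNr.
- by move=> *; exact: mulrA.
- by move=> *; exact: mulrC.
- by move=> *; rewrite rmorph1 mul1r.
- by move=> *; exact: mulrDl.
- by move=> *; exact: rmorphD.
- by move=> *; exact: rmorphM.
Qed.

Definition sym_lift (x : Sym) : S := sym_eval (repr x).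

Lemma sym_liftE x : sym_lift (sym_class x) = sym_eval x.
Proof. exact/sym_eval_rel/sym_reprP. Qed.

Lemma sym_lift_const a : sym_lift (sym_const a) = phi a.
Proof. exact: sym_liftE. Qed.

Lemma sym_lift_inj u : sym_lift (sym_inj u) = f u.
Proof. exact: sym_liftE. Qed.

Lemma sym_liftD : {morph sym_lift : x y / x + y}.
Proof. by move=> x y; rewrite [x + y]/(sym_class _) sym_liftE. Qed.

Lemma sym_liftM : {morph sym_lift : x y / x * y}.
Proof. by move=> x y; rewrite [x * y]/(sym_class _) sym_liftE. Qed.

Lemma sym_lift_unique (g : {rmorphism Sym -> S}) :
  (forall a, g (sym_const a) = phi a) -> (forall u, g (sym_inj u) = f u) ->
  g =1 sym_lift.
Proof.
move=> gC gI x; rewrite -[x]sym_classK sym_liftE.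
elim: (repr x) => //= {x} [x IHx y IHy|x IHx y IHy].
  by rewrite -sym_addrE -IHx -IHy -rmorphD.
by rewrite -sym_mulrE -IHx -IHy -rmorphM.
Qed.

End Lift.

(* The nth graded component: the R-span of the n-fold products of elements
   of M. *)
Fact sym_component_subproof (n : nat) : submod_closed
  [pred x : Sym | `[< exists s : seq (R * n.-tuple M),
     x = \sum_(c <- s) c.1 *: \prod_(u <- c.2) sym_inj u >]].
Proof.
split=> [|a x y]; rewrite !inE.
  by exists [::]; rewrite big_nil.
move=> [s ->] [t ->].
exists ([seq (a * c.1, c.2) | c <- s] ++ t).
rewrite big_cat big_map scaler_sumr; congr (_ + _).
by apply: eq_bigr => c _; rewrite scalerA.
Qed.
Definition sym_component n : submodule Sym :=
  Submodule (sym_component_subproof n).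

End SymmetricAlgebra.

Section SymmetricFunctor.
Variable R : comPzRingType.

Section Map.
Variables (M N : lmodType R) (f : {linear M -> N}).

Definition sym_map : Sym M -> Sym N :=
  sym_lift (@sym_const R N) (fun u => sym_inj (f u)).

Fact sym_map_genD : {morph (fun u => sym_inj (f u)) : u v / u + v}.
Proof. by move=> u v; rewrite !raddfD. Qed.
Fact sym_map_genZ a u : sym_inj (f (a *: u)) = sym_const N a * sym_inj (f u).
Proof. by rewrite !linearZ. Qed.

Lemma sym_map_const a : sym_map (sym_const M a) = sym_const N a.
Proof. exact: (sym_lift_const sym_map_genD sym_map_genZ). Qed.
Lemma sym_map_inj u : sym_map (sym_inj u) = sym_inj (f u).
Proof. exact: (sym_lift_inj sym_map_genD sym_map_genZ). Qed.

Fact sym_mapM : {morph sym_map : x y / x * y}.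
Proof. exact: (sym_liftM sym_map_genD sym_map_genZ). Qed.
Fact sym_map_linear : linear sym_map.
Proof.
move=> a x y; rewrite !sym_scaleE [LHS](sym_liftD sym_map_genD sym_map_genZ).
by rewrite -/sym_map sym_mapM sym_map_const.
Qed.

HB.instance Definition _ :=
  GRing.isLinear.Build R (Sym M) (Sym N) *:%R sym_map sym_map_linear.

Fact sym_map_monoid : monoid_morphism sym_map.
Proof. by split; [exact: sym_map_const | exact: sym_mapM]. Qed.

HB.instance Definition _ :=
  GRing.isMonoidMorphism.Build (Sym M) (Sym N) sym_map sym_map_monoid.

End Map.

Lemma sym_map_comp (M N P : lmodType R) (g : {linear N -> P})
    (f : {linear M -> N}) x : sym_map (g \o f) x = sym_map g (sym_map f x).
Proof.
rewrite -[x]sym_classK; elim: (repr x) => {x} [a|u|x IHx y IHy|x IHx y IHy].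
- by rewrite !sym_map_const.
- by rewrite !sym_map_inj.
- by rewrite -sym_addrE !raddfD /= IHx IHy.
- by rewrite -sym_mulrE !rmorphM /= IHx IHy.
Qed.

Lemma sym_map_component (M N : lmodType R) (f : {linear M -> N}) n x :
  x \in sym_component M n -> sym_map f x \in sym_component N n.
Proof.
move=> /asboolP[s ->]; apply/asboolP.
exists [seq (c.1, map_tuple f c.2) | c <- s].
rewrite big_map raddf_sum /=; apply: eq_bigr => c _; rewrite (linearZ_LR (sym_map f)) /=.
rewrite rmorph_prod big_map; congr (_ *: _).
by apply: eq_bigr => u _; rewrite -sym_map_inj.
Qed.

End SymmetricFunctor.

Section ReesAlgebra.
Variable R : comPzRingType.

Section Def.
Variable M : lmodType R.

Fact rees_ideal_subproof : submod_closed
  [pred x : Sym M | `[< forall (F : lmodType R) (g : {linear M -> F}),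
     free_module F -> sym_map g x = 0 >]].
Proof.
split=> [|a x y]; rewrite !inE.
  by move=> F g _; rewrite raddf0.
move=> hx hy F g Ffree.
by rewrite linearP /= hx // hy // scaler0 addr0.
Qed.
Definition rees_ideal : submodule (Sym M) := Submodule rees_ideal_subproof.

Lemma rees_idealP x : x \in rees_ideal <->
  forall (F : lmodType R) (g : {linear M -> F}),
    free_module F -> sym_map g x = 0.
Proof. by split => /asboolP. Qed.

Lemma rees_idealMl x y : y \in rees_ideal -> x * y \in rees_ideal.
Proof.
move=> /rees_idealP hy; apply/rees_idealP => F g Ffree.
by rewrite rmorphM /= hy // mulr0.
Qed.

Definition Rees := quotmod rees_ideal.
HB.instance Definition _ := GRing.Lmodule.on Rees.

Definition rees_pi : Sym M -> Rees := @quotmod_pi R (Sym M) rees_ideal.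
HB.instance Definition _ := GRing.Linear.on rees_pi.

Definition rees_mul (x y : Rees) : Rees := rees_pi (repr x * repr y).

Lemma rees_mulE x y : rees_mul (rees_pi x) (rees_pi y) = rees_pi (x * y).
Proof.
apply/quotmod_eqP; set x' := repr _; set y' := repr _.
have hx : x' - x \in rees_ideal by apply/quotmod_eqP; exact: quotmod_piK.
have hy : y' - y \in rees_ideal by apply/quotmod_eqP; exact: quotmod_piK.
have -> : x' * y' - x * y = y' * (x' - x) + x * (y' - y).
  by rewrite !mulrBr addrA [y' * x']mulrC [y' * x]mulrC subrK.
by rewrite rpredD ?rees_idealMl.
Qed.

Lemma rees_piK (x : Rees) : rees_pi (repr x) = x.
Proof. exact: quotmod_piK. Qed.

Fact rees_mulA : associative rees_mul.
Proof.
move=> x y z; rewrite -[x]rees_piK -[y]rees_piK -[z]rees_piK !rees_mulE.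
by rewrite mulrA.
Qed.
Fact rees_mulC : commutative rees_mul.
Proof. by move=> x y; rewrite /rees_mul mulrC. Qed.
Fact rees_mul1 : left_id (rees_pi 1) rees_mul.
Proof. by move=> x; rewrite -[x]rees_piK rees_mulE mul1r. Qed.
Fact rees_mulDl : left_distributive rees_mul +%R.
Proof.
move=> x y z; rewrite -[x]rees_piK -[y]rees_piK -[z]rees_piK.
by rewrite -raddfD !rees_mulE mulrDl raddfD.
Qed.

HB.instance Definition _ := GRing.Zmodule_isComPzRing.Build Rees
  rees_mulA rees_mulC rees_mul1 rees_mulDl.

Fact rees_pi_monoid : monoid_morphism rees_pi.
Proof. by split=> // x y; rewrite -rees_mulE. Qed.

HB.instance Definition _ :=
  GRing.isMonoidMorphism.Build (Sym M) Rees rees_pi rees_pi_monoid.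

Definition rees_component (n : nat) : submodule Rees :=
  submod_image rees_pi (sym_component M n).

End Def.

Section Map.
Variables (M N : lmodType R) (f : {linear M -> N}).

Definition rees_map (x : Rees M) : Rees N := rees_pi (sym_map f (repr x)).

Lemma sym_map_rees_ideal x :
  x \in rees_ideal M -> sym_map f x \in rees_ideal N.
Proof.
move=> /rees_idealP hx; apply/rees_idealP => F g Ffree.
by rewrite -sym_map_comp hx.
Qed.

Lemma rees_mapE x : rees_map (rees_pi x) = rees_pi (sym_map f x).
Proof.
apply/quotmod_eqP; rewrite -raddfB; apply: sym_map_rees_ideal.
by apply/quotmod_eqP; exact: quotmod_piK.
Qed.

Fact rees_map_linear : linear rees_map.
Proof.
move=> a x y; rewrite -[x]rees_piK -[y]rees_piK -linearP !rees_mapE.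
by rewrite !linearP.
Qed.

HB.instance Definition _ :=
  GRing.isLinear.Build R (Rees M) (Rees N) *:%R rees_map rees_map_linear.

Fact rees_map_monoid : monoid_morphism rees_map.
Proof.
split=> [|x y]; first by rewrite -(rmorph1 (@rees_pi M)) rees_mapE !rmorph1.
by rewrite -[x]rees_piK -[y]rees_piK -rmorphM !rees_mapE !rmorphM.
Qed.

HB.instance Definition _ :=
  GRing.isMonoidMorphism.Build (Rees M) (Rees N) rees_map rees_map_monoid.

(* For M contained in N through f, [rees_component N n] is N^n and
   [rees_image_component n] is M^n. *)
Definition rees_image_component (n : nat) : submodule (Rees N) :=
  submod_image rees_map (rees_component M n).

Lemma rees_image_component_sub n x :
  x \in rees_image_component n -> x \in rees_component N n.
Proof.
move=> /asboolP[_ /asboolP[y hy <-] <-]; apply/asboolP.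
by exists (sym_map f y); [exact: sym_map_component | exact/esym/rees_mapE].
Qed.

Definition rees_quotient (n : nat) : lmodType R :=
  subquotient (rees_component N n) (rees_image_component n).

End Map.

End ReesAlgebra.

(* Main.v *)
(* A_n and B_n are the homogeneous components of standard graded R-algebras A in
   B, and nothing else about the Rees algebra matters.

   Finitely many primes occur.  Filter B by F_j = A + A B_1 + ... + A B_j.  If p
   is the annihilator of x modulo A, take j least such that some multiple r x
   with r outside p lies in F_j; then p is the annihilator of r x modulo
   F_{j-1}.  So p is associated to the quotient of A[B_1 t, t] by t, which is
   Noetherian.

   For each p, membership in Ass(B_n/A_n) is eventually constant.  It means that
   the elements of B_n carried into A_n by p do not all vanish in (B_n/A_n)_p.
   The elements of B carried into A by p form, modulo those killed by p, a
   finitely generated A-module; those killed by p form a finitely generated ideal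
   of B, which meets A in a finitely generated ideal of A.  Hence vanishing in a
   large degree propagates to the next one. *)
Require Import Defs.
From HB Require Import structures.
From mathcomp Require Import all_boot all_algebra.
From mathcomp Require Import boolp classical_sets functions cardinality.

Set Implicit Arguments.
Unset Strict Implicit.
Unset Printing Implicit Defensive.

Import GRing.Theory.
Local Open Scope ring_scope.
Local Open Scope classical_set_scope.

(** Equality of linear maps and of primes is decided classically, so that membership in finite lists
    of them makes sense. *)
HB.instance Definition _ (R : comPzRingType) (U V : lmodType R) :=
  gen_eqMixin {linear U -> V}.
HB.instance Definition _ (R : comPzRingType) := gen_eqMixin (Spec R).

(** * Operations on submodules *)

Section SubmoduleConstructions.
Variables (R : comPzRingType) (V : lmodType R).
Implicit Types (U W : submodule V) (x y : V).

Section FromProp.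
Variable P : V -> Prop.
Hypothesis P0 : P 0.
Hypothesis PD : forall a x y, P x -> P y -> P (a *: x + y).

Fact submod_of_subproof : submod_closed [pred x : V | `[< P x >]].
Proof.
by split=> [|a x y /asboolP Px /asboolP Py]; apply/asboolP; [|exact: PD].
Qed.
Definition submod_of : submodule V := Submodule submod_of_subproof.

Lemma submod_ofP x : x \in submod_of <-> P x.
Proof. by split=> /asboolP. Qed.
End FromProp.

Section Chain.
Variable J : nat -> submodule V.
Hypothesis J_succ : forall n, {subset J n <= J n.+1}.

Lemma chain_leq m n : (m <= n)%N -> {subset J m <= J n}.
Proof.
move=> /subnK <-; elim: (n - m)%N => // k IH x xJ; rewrite addSn.
exact/J_succ/IH.
Qed.

Fact chain_union0 : exists n, 0 \in J n.
Proof. by exists 0; rewrite rpred0. Qed.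
Fact chain_unionD a x y :
  (exists n, x \in J n) -> (exists n, y \in J n) ->
  exists n, a *: x + y \in J n.
Proof.
move=> [m xJ] [n yJ]; exists (maxn m n).
rewrite rpredD ?rpredZ //; first by rewrite (chain_leq (leq_maxl m n)).
by rewrite (chain_leq (leq_maxr m n)).
Qed.
Definition chain_union : submodule V := submod_of chain_union0 chain_unionD.

Lemma chain_unionP x : x \in chain_union <-> exists n, x \in J n.
Proof. exact: submod_ofP. Qed.

Lemma chain_union_seq (s : seq V) :
  {subset s <= chain_union} -> exists n, {subset s <= J n}.
Proof.
elim: s => [|x s IH] sJ; first by exists 0.
have [n sn] := IH (fun y ys => sJ y (mem_behead (s := x :: s) ys)).
have /chain_unionP[m xm] := sJ x (mem_head _ _).
exists (maxn m n) => y; rewrite inE => /predU1P[->|/sn ys].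
  exact: chain_leq (leq_maxl m n) _ xm.
exact: chain_leq (leq_maxr m n) _ ys.
Qed.
End Chain.

Fact submod_add0 U W : exists y w, [/\ y \in U, w \in W & 0 = y + w].
Proof. by exists 0, 0; rewrite !rpred0 addr0. Qed.
Fact submod_addD U W a x y :
  (exists u w, [/\ u \in U, w \in W & x = u + w]) ->
  (exists u w, [/\ u \in U, w \in W & y = u + w]) ->
  exists u w, [/\ u \in U, w \in W & a *: x + y = u + w].
Proof.
move=> [u [w [uU wW ->]]] [u' [w' [uU' wW' ->]]].
exists (a *: u + u'), (a *: w + w'); rewrite !rpredD ?rpredZ //; split=> //.
by rewrite scalerDr addrACA.
Qed.
Definition submod_add U W : submodule V :=
  submod_of (submod_add0 U W) (submod_addD (U := U) (W := W)).

Lemma submod_addP U W x :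
  x \in submod_add U W <-> exists u w, [/\ u \in U, w \in W & x = u + w].
Proof. exact: submod_ofP. Qed.

Fact submod_cap0 U W : 0 \in U /\ 0 \in W.
Proof. by split; rewrite rpred0. Qed.
Fact submod_capD U W a x y :
  x \in U /\ x \in W -> y \in U /\ y \in W ->
  a *: x + y \in U /\ a *: x + y \in W.
Proof. by move=> [xU xW] [yU yW]; split; rewrite rpredD ?rpredZ. Qed.
Definition submod_cap U W : submodule V :=
  submod_of (submod_cap0 U W) (submod_capD (U := U) (W := W)).

Lemma submod_capP U W x : x \in submod_cap U W <-> x \in U /\ x \in W.
Proof. exact: submod_ofP. Qed.

End SubmoduleConstructions.

Section Colon.
Variables (R : comPzRingType) (V : lmodType R).
Implicit Types (U W : submodule V).

Fact submod_colon0 U W : forall y, y \in U -> (0 : R) *: y \in W.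
Proof. by move=> y _; rewrite scale0r rpred0. Qed.
Fact submod_colonD U W (a : R) (r s : R^o) :
  (forall y, y \in U -> (r : R) *: y \in W) ->
  (forall y, y \in U -> (s : R) *: y \in W) ->
  forall y, y \in U -> (a *: r + s : R) *: y \in W.
Proof.
move=> rU sU y yU; rewrite scalerDl -scalerA.
by apply: rpredD; [apply: rpredZ; exact: rU | exact: sU].
Qed.
(** This is the ideal quotient (W : U), with the arguments in the opposite order. *)
Definition submod_colon U W : submodule R^o :=
  submod_of (@submod_colon0 U W) (@submod_colonD U W).

Lemma submod_colonP U W (r : R) :
  r \in submod_colon U W <-> forall y, y \in U -> r *: y \in W.
Proof. exact: (submod_ofP (@submod_colon0 U W) (@submod_colonD U W)). Qed.

End Colon.

Lemma noetherian_ideal (R : comPzRingType) (I : submodule R^o) :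
  noetherian R -> exists2 s : seq R, (forall r : R, r \in s -> r \in I) &
    forall r : R, r \in I -> exists c : nat -> R, r = \sum_(i < size s) c i * s`_i.
Proof.
move=> nR; have [s sP] := nR I.
exists (map (@submod_val R R^o I) s) => [_ /mapP[[r rI] _ ->] //|r rI].
have [c /(congr1 (@submod_val R R^o I))] := sP (SubmodElt rI).
rewrite raddf_sum size_map /= => ->; exists c; apply: eq_bigr => i _.
by rewrite (nth_map 0).
Qed.

(** * Commuting operators and Hilbert's basis theorem *)

(* A module over R with a list of commuting linear operators stands for a
   module over a polynomial ring over R. *)
Section Operators.
Variables (R : comPzRingType) (V : lmodType R).
Implicit Types (U W : submodule V) (ops : seq {linear V -> V}).

Definition stable ops U : Prop :=
  forall f : {linear V -> V}, f \in ops -> forall x, x \in U -> f x \in U.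

Section Generated.
Variables (ops : seq {linear V -> V}) (S : V -> Prop).

Fact generated0 U : stable ops U -> (forall y, S y -> y \in U) -> 0 \in U.
Proof. by rewrite rpred0. Qed.
Fact generatedD a x y :
  (forall U, stable ops U -> (forall y, S y -> y \in U) -> x \in U) ->
  (forall U, stable ops U -> (forall y, S y -> y \in U) -> y \in U) ->
  forall U, stable ops U -> (forall y, S y -> y \in U) -> a *: x + y \in U.
Proof. by move=> hx hy U oU SU; rewrite rpredD ?rpredZ ?hx ?hy. Qed.
(** Taking the intersection of all stable submodules containing [S] avoids writing polynomials in
    the operators and makes [generated_sub] an induction principle. With no operators it is the
    [R]-span. *)
Definition generated : submodule V := submod_of generated0 generatedD.

Lemma generatedP x : x \in generated <->
  forall U, stable ops U -> (forall y, S y -> y \in U) -> x \in U.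
Proof. exact: submod_ofP. Qed.

Lemma generated_sub U :
  stable ops U -> (forall y, S y -> y \in U) -> {subset generated <= U}.
Proof. by move=> oU SU x /generatedP; apply. Qed.

Lemma mem_generated x : S x -> x \in generated.
Proof. by move=> Sx; apply/generatedP => U _; apply. Qed.

Lemma generated_stable : stable ops generated.
Proof.
move=> f fo x /generatedP xG; apply/generatedP => U oU SU.
exact/oU/xG.
Qed.
End Generated.

Lemma stable_cap ops U W :
  stable ops U -> stable ops W -> stable ops (submod_cap U W).
Proof.
by move=> oU oW f fo x /submod_capP[xU xW]; apply/submod_capP; split;
  [exact: oU | exact: oW].
Qed.

Lemma stable_add ops U W :
  stable ops U -> stable ops W -> stable ops (submod_add U W).
Proof.
move=> oU oW f fo _ /submod_addP[u [w [uU wW ->]]]; apply/submod_addP.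
by exists (f u), (f w); rewrite raddfD; split=> //; [exact: oU | exact: oW].
Qed.

(** With no operators this is the usual Noetherian condition over [R]. [W] need not be stable, so
    the property passes to smaller submodules. *)
Definition noeth ops W : Prop :=
  forall U, stable ops U -> {subset U <= W} ->
    exists2 s : seq V, {subset s <= U} &
      {subset U <= generated ops (fun x => x \in s)}.

(** Without a maximal member, choice yields a strictly increasing chain. Its union is stable, hence
    finitely generated, and the generators already lie in one stage. *)
Lemma noeth_max ops W (P : submodule V -> Prop) U0 :
    noeth ops W -> (forall U, P U -> stable ops U /\ {subset U <= W}) -> P U0 ->
  exists2 U, P U & forall U', P U' -> {subset U <= U'} -> {subset U' <= U}.
Proof.
move=> nW PW PU0; apply: contrapT => nomax.
have next (U : {U | P U}) : exists U' : {U | P U},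
    {subset sval U <= sval U'} /\ ~ {subset sval U' <= sval U}.
  apply: contrapT => noU; apply: nomax; exists (sval U); first exact: svalP.
  move=> U' PU' UU'; apply: contrapT => U'U; apply: noU.
  by exists (exist _ U' PU').
have [g gP] := choice next.
pose J n := sval (iter n g (exist _ U0 PU0)).
have J_succ n : {subset J n <= J n.+1} by have [] := gP (iter n g (exist _ U0 PU0)).
have [f fJ x /chain_unionP[n xn]|x /chain_unionP[n xn]|s sJ Js] :=
  nW (chain_union J_succ).
- apply/chain_unionP; exists n.
  by have [oJ _] := PW _ (svalP (iter n g (exist _ U0 PU0))); exact: oJ.
- by have [_ JW] := PW _ (svalP (iter n g (exist _ U0 PU0))); exact: JW.
have [n sn] := chain_union_seq sJ.
have [_] := gP (iter n g (exist _ U0 PU0)); apply=> x xJ.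
have oJ : stable ops (J n) by have [] := PW _ (svalP (iter n g (exist _ U0 PU0))).
have : x \in chain_union J_succ by apply/chain_unionP; exists n.+1.
by move=> /Js; apply: generated_sub.
Qed.

(* Hilbert's basis theorem, for the submodule W of the sums of phi^i w_i with
   w_i in W0: a phi-stable submodule U of W is determined by the submodules of
   W0 formed by the leading coefficients of its elements of given degree. *)
Section HilbertBasis.
Variables (ops : seq {linear V -> V}) (phi : {linear V -> V}).
Variables (W0 : submodule V).
Hypothesis comm_phi : forall f : {linear V -> V}, f \in ops ->
  forall x, f (phi x) = phi (f x).
Hypothesis W0_stable : stable ops W0.

Let iterD n : {morph iter n phi : x y / x + y}.
Proof. by move=> x y; elim: n => //= n ->; rewrite raddfD. Qed.
Let iterZ n a : {morph iter n phi : x / a *: x}.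
Proof. by move=> x; elim: n => //= n ->; rewrite linearZ. Qed.
Let iter0 n : iter n phi 0 = 0.
Proof. by elim: n => //= n ->; rewrite raddf0. Qed.
Let iter_comm n (f : {linear V -> V}) :
  f \in ops -> {morph iter n phi : x / f x}.
Proof. by move=> fo x; elim: n => //= n ->; rewrite comm_phi. Qed.

(** The degree is strictly below [d], so [d = 0] leaves only zero. The coefficients need not be
    unique. *)
Fixpoint low_degree_prop (d : nat) (x : V) : Prop :=
  if d is d'.+1 then exists2 w, w \in W0 & low_degree_prop d' (x - iter d' phi w)
  else x = 0.

Fact low_degree0 d : low_degree_prop d 0.
Proof.
by elim: d => //= d IH; exists 0; rewrite ?rpred0 // iter0 subr0.
Qed.
Fact low_degreeD d a x y :
  low_degree_prop d x -> low_degree_prop d y -> low_degree_prop d (a *: x + y).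
Proof.
elim: d x y => [|d IH] x y /=; first by move=> -> ->; rewrite scaler0 addr0.
move=> [w wW xw] [v vW yv]; exists (a *: w + v); first by rewrite rpredD ?rpredZ.
by rewrite iterD iterZ opprD addrACA -scalerBr; exact: IH.
Qed.
Definition low_degree d : submodule V :=
  submod_of (low_degree0 d) (low_degreeD (d := d)).

Lemma low_degreeS d x : x \in low_degree d.+1 <->
  exists2 w, w \in W0 & x - iter d phi w \in low_degree d.
Proof.
split=> [/submod_ofP[w wW xw]|[w wW /submod_ofP xw]].
  by exists w => //; apply/submod_ofP.
by apply/submod_ofP; exists w.
Qed.

Lemma low_degree_succ d : {subset low_degree d <= low_degree d.+1}.
Proof.
by move=> x xd; apply/low_degreeS; exists 0; rewrite ?rpred0 // iter0 subr0.
Qed.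

Lemma low_degree_stable d : stable ops (low_degree d).
Proof.
move=> f fo; elim: d => [|d IH] x.
  by move=> /submod_ofP ->; rewrite raddf0 rpred0.
move=> /low_degreeS[w wW xw]; apply/low_degreeS; exists (f w).
  exact: W0_stable.
by rewrite iter_comm // -raddfB IH.
Qed.

Lemma low_degree_phi d x : x \in low_degree d -> phi x \in low_degree d.+1.
Proof.
elim: d x => [|d IH] x.
  by move=> /submod_ofP ->; rewrite raddf0 rpred0.
move=> /low_degreeS[w wW xw]; apply/low_degreeS; exists w => //.
by rewrite iterS -raddfB IH.
Qed.

Fact lead0 U d : (0 : V) \in W0 /\
  exists2 u, u \in U & u - iter d phi 0 \in low_degree d.
Proof.
split; first by rewrite rpred0.
by exists 0; rewrite ?rpred0 // iter0 subr0 rpred0.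
Qed.
Fact leadD U d a x y :
  x \in W0 /\ (exists2 u, u \in U & u - iter d phi x \in low_degree d) ->
  y \in W0 /\ (exists2 u, u \in U & u - iter d phi y \in low_degree d) ->
  a *: x + y \in W0 /\
    (exists2 u, u \in U & u - iter d phi (a *: x + y) \in low_degree d).
Proof.
move=> [xW [u uU ux]] [yW [v vU vy]]; split; first by rewrite rpredD ?rpredZ.
exists (a *: u + v); first by rewrite rpredD ?rpredZ.
by rewrite iterD iterZ opprD addrACA -scalerBr rpredD ?rpredZ.
Qed.
Definition lead U d : submodule V :=
  submod_of (lead0 U d) (leadD (U := U) (d := d)).

Lemma leadP U d w : w \in lead U d <->
  w \in W0 /\ exists2 u, u \in U & u - iter d phi w \in low_degree d.
Proof. exact: submod_ofP. Qed.

Lemma lead_stable U d : stable ops U -> stable ops (lead U d).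
Proof.
move=> oU f fo w /leadP[wW [u uU uw]]; apply/leadP; split; first exact: W0_stable.
by exists (f u); [exact: oU | rewrite iter_comm // -raddfB low_degree_stable].
Qed.

Lemma lead_succ U d : stable [:: phi] U -> {subset lead U d <= lead U d.+1}.
Proof.
move=> oU w /leadP[wW [u uU uw]]; apply/leadP; split=> //.
exists (phi u); first by apply: oU; rewrite ?mem_head.
by rewrite iterS -raddfB low_degree_phi.
Qed.

(** Induction on the degree: subtracting an element of [U'] with the same leading coefficient leaves
    an element of [U] of lower degree. *)
Lemma sub_from_lead U U' :
  {subset U' <= U} -> (forall d, {subset lead U d <= lead U' d}) ->
  {subset U <= chain_union low_degree_succ} -> {subset U <= U'}.
Proof.
move=> U'U leadU UW x xU; have /chain_unionP[d] := UW x xU.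
elim: d x xU => [|d IH] x xU; first by move=> /submod_ofP ->; rewrite rpred0.
move=> /low_degreeS[w wW xw].
have /leadU/leadP[_ [u uU' uw]] : w \in lead U d.
  by apply/leadP; split=> //; exists x.
rewrite -[x](subrK u) rpredD // IH //; first by rewrite rpredB // U'U.
have -> : x - u = (x - iter d phi w) - (u - iter d phi w).
  by rewrite opprB addrA subrK.
exact: rpredB.
Qed.

Lemma lead_lift U d (s : seq V) : {subset s <= lead U d} ->
  exists2 t : seq V, {subset t <= U} &
    forall U', {subset t <= U'} -> {subset s <= lead U' d}.
Proof.
elim: s => [|w s IH] sU; first by exists [::].
have [t tU ts] := IH (fun y ys => sU y (mem_behead (s := w :: s) ys)).
have /leadP[wW [u uU uw]] := sU w (mem_head _ _).
exists (u :: t) => [x|U' tU' x]; rewrite inE => /predU1P[->|] //; first exact: tU.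
  by apply/leadP; split=> //; exists u => //; apply: tU'; rewrite mem_head.
by move=> xs; apply: ts => // y yt; apply: tU'; rewrite inE yt orbT.
Qed.

(** The leading submodules of [U] increase with the degree, hence are constant from some [d0] on.
    Lifts of generators of those in degrees up to [d0] generate a submodule with the same leading
    coefficients as [U] in every degree. *)
Lemma noeth_adjoin : noeth ops W0 ->
  noeth (phi :: ops) (chain_union low_degree_succ).
Proof.
move=> nW0 U oU UW.
have stable_ops U' : stable (phi :: ops) U' -> stable ops U'.
  by move=> oU' f fo; apply: oU'; rewrite inE fo orbT.
have stable_phi U' : stable (phi :: ops) U' -> stable [:: phi] U'.
  by move=> oU' f; rewrite inE => /eqP ->; apply: oU'; rewrite mem_head.
have lead_fg d : exists t : seq V, {subset t <= U} /\
    forall U', stable (phi :: ops) U' -> {subset t <= U'} ->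
      {subset lead U d <= lead U' d}.
  have [|x /leadP[]//|s sU Us] := nW0 (lead U d).
    exact/lead_stable/stable_ops.
  have [t tU ts] := lead_lift sU; exists t; split=> // U' oU' tU' x /Us.
  by apply: generated_sub; [exact/lead_stable/stable_ops | exact: ts].
have [t tP] := choice lead_fg.
have lsucc d : {subset lead U d <= lead U d.+1} by apply/lead_succ/stable_phi.
have [f fo x /chain_unionP[n xn]|x /chain_unionP[n /leadP[]]//|s sU Us] :=
  nW0 (chain_union lsucc).
  by apply/chain_unionP; exists n; apply: lead_stable => //; exact: stable_ops.
have [d0 sd0] := chain_union_seq sU.
exists (flatten [seq t d | d <- iota 0 d0.+1]) => [x /flatten_mapP[d _]|].
  by have [tU _] := tP d; exact: tU.
set G := generated _ _.
have oG : stable (phi :: ops) G by exact: generated_stable.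
have tG d : (d <= d0)%N -> {subset t d <= G}.
  move=> dd0 x xt; apply: mem_generated; apply/flatten_mapP; exists d => //.
  by rewrite mem_iota.
apply: sub_from_lead => //.
  apply: generated_sub => // x /flatten_mapP[d _].
  by have [tU _] := tP d; exact: tU.
have leadG d : (d <= d0)%N -> {subset lead U d <= lead G d}.
  by move=> dd0; have [_] := tP d; apply=> //; exact: tG.
move=> d x xd; have [/leadG|/ltnW d0d] := leqP d d0; first exact.
apply: (@chain_leq _ _ (lead G) (fun n => lead_succ (stable_phi _ oG)) _ _ d0d).
apply: leadG => //.
have : x \in chain_union lsucc by apply/chain_unionP; exists d.
by move=> /Us; apply: generated_sub => //; exact/lead_stable/stable_ops.
Qed.

Lemma low_degree_union_stable :
  stable (phi :: ops) (chain_union low_degree_succ).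
Proof.
move=> f; rewrite inE => /predU1P[->|fo] x /chain_unionP[d xd]; apply/chain_unionP.
  by exists d.+1; exact: low_degree_phi.
by exists d; exact: low_degree_stable.
Qed.

Lemma W0_low_degree : {subset W0 <= chain_union low_degree_succ}.
Proof.
move=> x xW; apply/chain_unionP; exists 1; apply/low_degreeS; exists x => //.
by rewrite subrr rpred0.
Qed.

End HilbertBasis.

Lemma noeth_sub ops W W' : {subset W' <= W} -> noeth ops W -> noeth ops W'.
Proof. by move=> W'W nW U oU UW'; apply: nW => // x /UW'/W'W. Qed.

Definition commuting ops : Prop := forall f g : {linear V -> V},
  f \in ops -> g \in ops -> forall x, f (g x) = g (f x).

(** The operators are adjoined one at a time: what [phi :: ops] generates from [e] consists of sums
    of powers of [phi] applied to what [ops] generates from [e]. *)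
Lemma noeth_generated1 ops e : noetherian R -> commuting ops ->
  noeth ops (generated ops (eq e)).
Proof.
move=> nR; elim: ops => [_|phi ops IH comm].
  move=> U _ Ue.
  (* Without operators [U] lies in [R e], so it equals [cyc] times [e], and generators of the ideal
     [cyc] give generators of [U]. *)
  pose cyc : submodule R^o := submod_colon (generated [::] (eq e)) U.
  have [s sI sP] := noetherian_ideal cyc nR.
  exists [seq r *: e | r <- s].
    move=> _ /mapP[r /sI/submod_colonP rU ->]; apply: rU.
    exact: mem_generated.
  move=> x xU; have /generatedP xe := Ue x xU.
  have line0 : exists r : R, 0 = r *: e by exists 0; rewrite scale0r.
  have lineD a y z : (exists r : R, y = r *: e) -> (exists r : R, z = r *: e) ->
      exists r : R, a *: y + z = r *: e.
    by move=> [r ->] [r' ->]; exists (a * r + r'); rewrite scalerDl scalerA.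
  have /submod_ofP[r xr] : x \in submod_of line0 lineD.
    by apply: xe => // _ <-; apply/submod_ofP; exists 1; rewrite scale1r.
  have /sP[c rE] : r \in cyc.
    apply/submod_colonP => y /generatedP ye.
    have /submod_ofP[r' ->] : y \in submod_of line0 lineD.
      by apply: ye => // _ <-; apply/submod_ofP; exists 1; rewrite scale1r.
    by rewrite scalerA mulrC -scalerA -xr rpredZ.
  rewrite xr rE scaler_suml rpred_sum // => i _.
  rewrite -scalerA rpredZ // mem_generated //.
  by apply/mapP; exists s`_i => //; exact: mem_nth.
have commo : commuting ops.
  by move=> f g fo go; apply: comm; rewrite inE ?fo ?go orbT.
have comm_phi (f : {linear V -> V}) : f \in ops -> forall x, f (phi x) = phi (f x).
  by move=> fo; apply: comm; rewrite ?mem_head // inE fo orbT.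
set W0 := generated ops (eq e).
have oW0 : stable ops W0 by exact: generated_stable.
have nW := noeth_adjoin comm_phi oW0 (IH commo).
apply: noeth_sub nW.
apply: generated_sub; first exact: low_degree_union_stable.
by move=> _ <-; apply: W0_low_degree; exact: mem_generated.
Qed.

End Operators.

(** * Associated primes of a Noetherian quotient *)

Lemma prime_idealM_contra (R : comPzRingType) (p : Spec R) (r s : R) :
  r \notin p -> s \notin p -> r * s \notin p.
Proof.
by move=> rp sp; apply/negP => /prime_idealM; rewrite (negPf rp) (negPf sp).
Qed.

Lemma Spec_ext (R : comPzRingType) (p q : Spec R) :
  (forall r : R, (r \in p) = (r \in q)) -> p = q.
Proof.
case: p q => [[P P_closed] P_proper PM] [[Q Q_closed] Q_proper QM] PQ.
have E : P = Q by apply: funext => r; exact: PQ r.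
subst Q; have E := Prop_irrelevance P_closed Q_closed; subst Q_closed.
by rewrite (Prop_irrelevance P_proper Q_proper) (Prop_irrelevance PM QM).
Qed.

(** The associated primes of W0 / (W0 :&: W), expressed inside [V] so that no quotient has to be
    formed. *)
Definition Ass_quot (R : comPzRingType) (V : lmodType R) (W0 W : submodule V) :
    set (Spec R) :=
  [set p : Spec R | exists2 x, x \in W0 & forall r : R, r \in p <-> r *: x \in W].

Section FiniteAss.
Variables (R : comPzRingType) (V : lmodType R).
Implicit Types (U W : submodule V) (ops : seq {linear V -> V}).

Lemma Ass_quot_self W : Ass_quot W W = set0.
Proof.
apply/seteqP; split=> // p [x xW px]; have := prime_ideal_proper p.
by move/negP; apply; apply/px; rewrite rpredZ.
Qed.

(** Noetherian induction: a stable submodule [U] between [W] and [W0], maximal with finite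
    [Ass_quot U W], must be [W0], since otherwise it can be enlarged at the cost of at most one new
    prime. *)
Lemma finite_Ass_quot ops W0 W : noetherian R ->
  noeth ops W0 -> stable ops W0 -> stable ops W -> {subset W <= W0} ->
  finite_set (Ass_quot W0 W).
Proof.
move=> nR nW0 oW0 oW WW0.
pose good U := [/\ stable ops U, {subset U <= W0}, {subset W <= U} &
  finite_set (Ass_quot U W)].
have goodW : good W by split=> //; rewrite Ass_quot_self; exact: finite_set0.
have goodP U : good U -> stable ops U /\ {subset U <= W0} by case.
have [U [oU UW0 WU finU] maxU] := noeth_max nW0 goodP goodW.
have [W0U|nW0U] := pselect {subset W0 <= U}.
  apply: sub_finite_set finU => p [x xW0 px]; exists x => //; exact: W0U.
exfalso.
(* The operators are R-linear, so an element and the stable submodule that it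
   generates have the same annihilator.  Hence if Y, not contained in U, has the
   largest possible annihilator p modulo U, then p is prime and is the
   annihilator modulo U of every element of Y outside U. *)
pose colon (I : submodule R^o) := exists Y : submodule V,
  [/\ stable ops Y, {subset Y <= W0}, ~ {subset Y <= U} & I = submod_colon Y U].
(* [submod_colon W0 W0] is all of [R]; this puts the Noetherian hypothesis on [R] in the form
   required by [noeth_max]. *)
have nRo : noeth [::] (submod_colon W0 W0).
  move=> I _ _; have [s sI Is] := noetherian_ideal I nR.
  exists s => // r /Is[c ->]; apply: rpred_sum => i _.
  have : (s`_i : R^o) \in generated [::] (fun x : R^o => x \in (s : seq R^o)).
    by apply: mem_generated; exact: mem_nth.
  by move=> /(rpredZ (c i)).
have colonW0 : colon (submod_colon W0 U) by exists W0; split.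
have colonP I : colon I -> stable [::] I /\ {subset I <= submod_colon W0 W0}.
  move=> _; split=> [f|r _]; first by rewrite in_nil.
  by apply/(submod_colonP W0 W0) => x; exact: rpredZ.
have [_ [Y [oY YW0 nYU ->]] maxI] := noeth_max nRo colonP colonW0.
have colon_eq Y' : stable ops Y' -> {subset Y' <= Y} -> ~ {subset Y' <= U} ->
    {subset submod_colon Y' U <= submod_colon Y U}.
  move=> oY' Y'Y nY'U; apply: maxI; first by exists Y'; split=> // x /Y'Y/YW0.
  move=> r /(submod_colonP Y U) rYU.
  by apply/(submod_colonP Y' U) => y /Y'Y; exact: rYU.
have ann_eq y r : y \in Y -> y \notin U -> r *: y \in U -> r \in submod_colon Y U.
  move=> yY yU ryU.
  pose Y' := submod_cap Y (generated ops (eq y)).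
  have yY' : y \in Y' by apply/submod_capP; split=> //; exact: mem_generated.
  apply: (colon_eq Y').
  - by apply: stable_cap => //; exact: generated_stable.
  - by move=> x /submod_capP[].
  - by move=> /(_ y yY'); rewrite (negPf yU).
  have ann0 : r *: (0 : V) \in U by rewrite scaler0 rpred0.
  have annD a x x' : r *: x \in U -> r *: x' \in U -> r *: (a *: x + x') \in U.
    move=> xU x'U; rewrite scalerDr scalerA mulrC -scalerA.
    by apply: rpredD => //; exact: rpredZ.
  apply/(submod_colonP Y' U) => x /submod_capP[_ /generatedP xG].
  have /submod_ofP // : x \in submod_of ann0 annD.
  apply: xG => [f fo z /submod_ofP zU|_ <-]; apply/submod_ofP => //.
  by rewrite -linearZ; exact: oU.
have [y yY yU] : exists2 y, y \in Y & y \notin U.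
  apply: contrapT => noy; apply: nYU => y yY.
  by apply: contrapT => /negP yU; apply: noy; exists y.
have p_proper : (1 : R) \notin submod_colon Y U.
  apply/negP => /(submod_colonP Y U) /(_ y yY); rewrite scale1r.
  by rewrite (negPf yU).
have p_prime (r s : R) : r * s \in submod_colon Y U ->
    (r \in submod_colon Y U) || (s \in submod_colon Y U).
  move=> /(submod_colonP Y U) /(_ y yY); rewrite -scalerA => rsy.
  have [sy|sy] := boolP (s *: y \in U); first by rewrite (ann_eq y s) ?orbT.
  by rewrite (ann_eq (s *: y) r) // rpredZ.
pose p := PrimeIdeal p_proper p_prime.
have UYU : {subset U <= submod_add Y U}.
  by move=> x xU; apply/submod_addP; exists 0, x; rewrite rpred0 add0r.
suff : good (submod_add Y U).
  move=> goodYU; move/negP: yU; apply; apply: (maxU _ goodYU UYU).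
  by apply/submod_addP; exists y, 0; rewrite rpred0 addr0.
split.
- exact: stable_add.
- move=> _ /submod_addP[u [v [uY vU ->]]].
  by apply: rpredD; [exact: YW0 | exact: UW0].
- by move=> x /WU/UYU.
apply: (@sub_finite_set _ _ (Ass_quot U W `|` [set p])); last first.
  by rewrite finite_setU; split=> //; exact: finite_set1.
move=> q [x /submod_addP[u [v [uY vU xE]]] qx].
(* A multiple of [x] by a scalar outside [q] still has annihilator [q] modulo [W]. If none lies in
   [U], then [u] is outside [U] and [q] is its annihilator modulo [U], that is [p]. *)
have [[r rq rxU]|norU] := pselect (exists2 r : R, r \notin q & r *: x \in U).
  left; exists (r *: x) => // s; rewrite scalerA; split=> [sq|/qx].
    by apply/qx; rewrite mulrC; exact: (rpredZ r sq).
  by move=> /prime_idealM; rewrite (negPf rq) orbF.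
right; apply: Spec_ext => r; apply/idP/idP => [rq|/(submod_colonP Y U) rYU].
  apply: (ann_eq u) => //.
    apply/negP => uU; apply: norU; exists 1; first exact: prime_ideal_proper.
    by rewrite scale1r xE rpredD.
  have /WU := (qx r).1 rq; rewrite xE scalerDr => rx.
  by rewrite -[r *: u](addrK (r *: v)) rpredB // rpredZ.
apply: contrapT => /negP rq; apply: norU; exists r => //.
by rewrite xE scalerDr; apply: rpredD; [exact: rYU | exact: rpredZ].
Qed.

End FiniteAss.

(** * Sequences as formal power series *)

Section Sequences.
Variable R : comPzRingType.

Section Shift.
Variables (V W : lmodType R) (phi : {linear V -> W}).

(** With a sequence read as a power series in a variable, [shift phi] is [phi] times the variable,
    and [pointwise phi] is [phi] on coefficients. *)
Definition shift (f : nat -> V) : nat -> W :=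
  fun n => if n is m.+1 then phi (f m) else 0.
Fact shift_linear : linear shift.
Proof.
move=> a f g; apply: funext => -[|n]; last exact: linearP.
exact/esym/(etrans (addr0 _))/scaler0.
Qed.
HB.instance Definition _ := GRing.isLinear.Build R (nat -> V) (nat -> W) *:%R
  shift shift_linear.

Definition pointwise (f : nat -> V) : nat -> W := fun n => phi (f n).
Fact pointwise_linear : linear pointwise.
Proof. by move=> a f g; apply: funext => n; exact: linearP. Qed.
HB.instance Definition _ := GRing.isLinear.Build R (nat -> V) (nat -> W) *:%R
  pointwise pointwise_linear.
End Shift.

Section Delta.
Variables (V : lmodType R) (n : nat).
Definition delta (x : V) : nat -> V := fun m => if m == n then x else 0.
Fact delta_linear : linear delta.
Proof.
move=> a x y; apply: funext => m.
transitivity (a *: delta x m + delta y m); last by [].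
by rewrite /delta; case: eqP => _ //; rewrite scaler0 addr0.
Qed.
HB.instance Definition _ := GRing.isLinear.Build R V (nat -> V) *:%R
  delta delta_linear.
End Delta.

Lemma delta_eq (V : lmodType R) n (x : V) : delta n x n = x.
Proof. by rewrite /delta eqxx. Qed.

Lemma shift_delta (V W : lmodType R) (phi : {linear V -> W}) n x :
  shift phi (delta n x) = delta n.+1 (phi x).
Proof.
apply: funext => -[|m] //; rewrite /shift /delta eqSS.
by case: eqP => // _; rewrite raddf0.
Qed.

Lemma pointwise_delta (V W : lmodType R) (phi : {linear V -> W}) n x :
  pointwise phi (delta n x) = delta n (phi x).
Proof.
apply: funext => m; rewrite /pointwise /delta.
by case: eqP => // _; rewrite raddf0.
Qed.

Lemma shift_comm (V : lmodType R) (phi psi : {linear V -> V}) :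
  (forall x, phi (psi x) = psi (phi x)) ->
  forall f, shift phi (shift psi f) = shift psi (shift phi f).
Proof.
by move=> pp f; apply: funext => -[|[|n]] //=; rewrite ?raddf0 ?pp.
Qed.

Lemma pointwise_shift_comm (V : lmodType R) (phi psi : {linear V -> V}) :
  (forall x, phi (psi x) = psi (phi x)) ->
  forall f, pointwise phi (shift psi f) = shift psi (pointwise phi f).
Proof.
by move=> pp f; apply: funext => -[|n] /=; rewrite /pointwise /= ?raddf0 ?pp.
Qed.

End Sequences.

(** * Standard graded algebras and finiteness of the primes *)

Section Graded.
Variables (R : comPzRingType) (E : lmodType R).
Implicit Types (ops aops bops : seq {linear E -> E}) (U W : submodule E).
Implicit Types (A B X : nat -> submodule E).

Definition images ops U (y : E) : Prop :=
  exists (f : {linear E -> E}) x, [/\ f \in ops, x \in U & y = f x].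

Definition span_images ops U : submodule E := generated [::] (images ops U).

Lemma mem_span_images ops U f x :
  f \in ops -> x \in U -> f x \in span_images ops U.
Proof. by move=> fo xU; apply: mem_generated; exists f, x. Qed.

Lemma span_images_sub ops U W :
  (forall f : {linear E -> E}, f \in ops -> forall x, x \in U -> f x \in W) ->
  {subset span_images ops U <= W}.
Proof.
by move=> UW; apply: generated_sub => // _ [f [x [fo xU ->]]]; exact: UW.
Qed.

(* The homogeneous components of a standard graded algebra over R with unit e,
   generated by elements acting as ops; they need not be independent in E. *)
Definition standard_graded (e : E) ops A : Prop :=
  (forall x, x \in A 0 <-> x \in generated [::] (eq e)) /\
  (forall n x, x \in A n.+1 <-> x \in span_images ops (A n)).

Definition graded_stable ops X : Prop :=
  forall n (f : {linear E -> E}), f \in ops -> forall x, x \in X n -> f x \in X n.+1.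

Lemma standard_graded_stable e ops A :
  standard_graded e ops A -> graded_stable ops A.
Proof. by move=> [_ AS] n f fo x xA; apply/AS/mem_span_images. Qed.

Lemma standard_graded_sub e aops bops A B : standard_graded e aops A ->
  standard_graded e bops B -> graded_stable aops B -> forall n, {subset A n <= B n}.
Proof.
move=> [A0 AS] [B0 _] aB; elim=> [x /A0/B0 //|n IH x /AS].
by apply: span_images_sub => f fo y /IH; exact: aB.
Qed.

Section GradedNoetherian.
Variables (e : E) (ops : seq {linear E -> E}) (A : nat -> submodule E).
Hypotheses (nR : noetherian R) (comm : commuting ops).
Hypothesis stdA : standard_graded e ops A.

(** As the components may overlap in [E], their external direct sum is realised in the sequences:
    [W0] is this sum, and each algebra generator acts by a shift. *)
Let V : lmodType R := nat -> E.
Let vops : seq {linear V -> V} :=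
  [seq (shift f : {linear V -> V}) | f : {linear E -> E} <- ops].
Let W0 : submodule V := generated vops (eq (delta 0 e)).

Let vops_comm : commuting vops.
Proof.
move=> _ _ /mapP[f fo ->] /mapP[g go ->] x; apply: shift_comm => y.
exact: comm.
Qed.

Let delta_W0 n x : x \in A n -> delta n x \in W0.
Proof.
have [A0 AS] := stdA.
elim: n x => [|n IH] x.
  move=> /A0; apply: (generated_sub (U := submod_preimage (delta 0) W0)) => //.
  by move=> _ <-; exact: mem_generated.
move=> /AS; apply: (span_images_sub (W := submod_preimage (delta n.+1) W0)).
move=> f fo y yA; suff: delta n.+1 (f y) \in W0 by [].
rewrite -shift_delta.
apply: (generated_stable (f := shift f)); last exact: IH.
by apply/mapP; exists f.
Qed.

Let W0_support f : f \in W0 -> exists d, forall n, (d <= n)%N -> f n = 0.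
Proof.
have P0 : exists d, forall n, (d <= n)%N -> (0 : V) n = 0 by exists 0.
have PD a (g h : V) : (exists d, forall n, (d <= n)%N -> g n = 0) ->
    (exists d, forall n, (d <= n)%N -> h n = 0) ->
    exists d, forall n, (d <= n)%N -> (a *: g + h) n = 0.
  move=> [d gd] [d' hd]; exists (maxn d d') => n; rewrite geq_max => /andP[dn d'n].
  transitivity (a *: g n + h n) => //.
  by rewrite gd // hd // scaler0 addr0.
move=> fW; apply/(submod_ofP P0 PD); move: f fW; apply: generated_sub => [|_ <-].
  move=> _ /mapP[f fo ->] g /submod_ofP[d gd]; apply/submod_ofP.
  by exists d.+1 => -[|n] // dn; rewrite /= gd ?raddf0.
by apply/submod_ofP; exists 1; case.
Qed.

(** The direct sum of the [X n] is a stable submodule of a Noetherian one. Above the degrees of its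
    finitely many generators, everything comes from the preceding degree. *)
Lemma graded_noetherian X : (forall n, {subset X n <= A n}) ->
  graded_stable ops X ->
  exists N, forall n, (N <= n)%N -> {subset X n.+1 <= span_images ops (X n)}.
Proof.
move=> XA oX.
have nW0 : noeth vops W0 by exact: noeth_generated1.
have P0 n : (0 : V) n \in X n by rewrite rpred0.
have PD a (f g : V) : (forall n, f n \in X n) -> (forall n, g n \in X n) ->
    forall n, (a *: f + g) n \in X n.
  by move=> fX gX n; apply: (rpredD (rpredZ a (fX n))).
pose U := submod_cap W0 (submod_of P0 PD).
have [f fo x /submod_capP[xW /submod_ofP xX]|x /submod_capP[] //|s sU Us] := nW0 U.
  apply/submod_capP; split; first exact: (generated_stable fo).
  have /mapP[g go ->] := fo.
  by apply/submod_ofP => -[|n] /=; [exact: rpred0 | exact: oX].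
have [N sN] : exists N, forall f : V, f \in s -> forall n, (N <= n)%N -> f n = 0.
  have : {subset s <= W0} by move=> x /sU /submod_capP[].
  elim: s {sU Us} => [|f s IH] sW; first by exists 0.
  have [d fd] := W0_support (sW f (mem_head _ _)).
  have [N sN] := IH (fun y ys => sW y (mem_behead (s := f :: s) ys)).
  exists (maxn d N) => g; rewrite inE => /predU1P[->|gs] n; rewrite geq_max.
    by move=> /andP[dn _]; exact: fd.
  by move=> /andP[_ Nn]; exact: sN.
exists N => n Nn x xX.
have Q0 m : (N <= m)%N -> (0 : V) m.+1 \in span_images ops (X m).
  by move=> _; exact: rpred0.
have QD a (f g : V) :
    (forall m, (N <= m)%N -> f m.+1 \in span_images ops (X m)) ->
    (forall m, (N <= m)%N -> g m.+1 \in span_images ops (X m)) ->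
    forall m, (N <= m)%N -> (a *: f + g) m.+1 \in span_images ops (X m).
  by move=> fX gX m Nm; apply: (rpredD (rpredZ a (fX m Nm)) (gX m Nm)).
have dU : delta n.+1 x \in U.
  apply/submod_capP; split; first exact/delta_W0/XA.
  apply/submod_ofP => m; rewrite /delta.
  by have [->|_] := eqVneq m n.+1; [exact: xX | exact: rpred0].
(* The generators vanish in the degrees concerned. Membership in [U] is carried along because
   applying an operator requires the previous component to lie in [X m]. *)
suff /submod_capP[_ /submod_ofP/(_ n Nn)] :
    delta n.+1 x \in submod_cap U (submod_of Q0 QD).
  by rewrite delta_eq.
have := Us _ dU; apply: generated_sub => [|f fs].
  move=> _ /mapP[f fo ->] g /submod_capP[/submod_capP[gW gX] _].
  have go : (shift f : {linear V -> V}) \in vops by apply/mapP; exists f.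
  apply/submod_capP; split.
    apply/submod_capP; split; first exact: (generated_stable go).
    move/submod_ofP: gX => gX.
    by apply/submod_ofP => -[|m] /=; [exact: rpred0 | exact: oX].
  move/submod_ofP: gX => gX.
  by apply/submod_ofP => m _ /=; apply: mem_span_images.
apply/submod_capP; split; first exact: sU.
by apply/submod_ofP => m Nm; rewrite (sN f fs) ?rpred0 // leqW.
Qed.

End GradedNoetherian.

Section Finiteness.
Variables (e : E) (aops bops : seq {linear E -> E}) (A B : nat -> submodule E).
Hypotheses (nR : noetherian R) (comm : commuting (aops ++ bops)).
Hypotheses (stdA : standard_graded e aops A) (stdB : standard_graded e bops B).
Hypothesis aB : graded_stable aops B.

(* The element [dd n j x] stands for x t^j in degree n, and W0 for the algebra
   A[B_1 t, t]. *)
Let V1 : lmodType R := nat -> E.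
Let V2 : lmodType R := nat -> V1.

(** The outer index is the degree and the inner one the exponent of [t]: generators [a] of A act by
    [aop], products [b t] by [bop], and [t] by [top]. *)
Let aop (f : {linear E -> E}) : {linear V2 -> V2} := shift (pointwise f).
Let bop (f : {linear E -> E}) : {linear V2 -> V2} := shift (shift f).
Let top : {linear V2 -> V2} := pointwise (shift (idfun : {linear E -> E})).
Let ops := top :: map aop aops ++ map bop bops.
Let dd n j (x : E) : V2 := delta n (delta j x).
Let W0 : submodule V2 := generated ops (eq (dd 0 0 e)).
Let tW0 : submodule V2 := submod_image top W0.

Let mem_aop f : f \in aops -> aop f \in ops.
Proof. by move=> fo; rewrite inE mem_cat (map_f aop fo) orbT. Qed.
Let mem_bop f : f \in bops -> bop f \in ops.
Proof. by move=> fo; rewrite inE mem_cat (map_f bop fo) !orbT. Qed.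

Let ops_comm : commuting ops.
Proof.
have cab f g x : f \in aops -> g \in bops -> f (g x) = g (f x).
  by move=> fo go; apply: comm; rewrite mem_cat ?fo ?go ?orbT.
have caa f g x : f \in aops -> g \in aops -> f (g x) = g (f x).
  by move=> fo go; apply: comm; rewrite mem_cat ?fo ?go ?orbT.
have cbb f g x : f \in bops -> g \in bops -> f (g x) = g (f x).
  by move=> fo go; apply: comm; rewrite mem_cat ?fo ?go ?orbT.
have ta f x : top (aop f x) = aop f (top x).
  apply: pointwise_shift_comm => {}x; apply/esym/pointwise_shift_comm => {}x.
  by [].
have tb f x : top (bop f x) = bop f (top x).
  by apply: pointwise_shift_comm => {}x; apply: shift_comm => {}x.
have Cab f g x : f \in aops -> g \in bops -> aop f (bop g x) = bop g (aop f x).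
  move=> fo go; apply: shift_comm => {}x; apply: pointwise_shift_comm => {}x.
  exact: cab.
move=> f g; rewrite !inE !mem_cat.
move=> /predU1P[->|/orP[/mapP[f' fo ->]|/mapP[f' fo ->]]];
move=> /predU1P[->|/orP[/mapP[g' go ->]|/mapP[g' go ->]]] x //.
- apply: shift_comm => {}x; apply: funext => j; exact: caa.
- exact: Cab.
- exact/esym/Cab.
- apply: shift_comm => {}x; apply: shift_comm => {}x; exact: cbb.
Qed.

Let W0_stable : stable ops W0. Proof. exact: generated_stable. Qed.

Let tW0_stable : stable ops tW0.
Proof.
move=> f fo _ /asboolP[x xW <-]; apply/asboolP; exists (f x).
  exact: W0_stable.
by apply: ops_comm => //; exact: mem_head.
Qed.

Let top_dd n j x : top (dd n j x) = dd n j.+1 x.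
Proof. by rewrite [LHS]pointwise_delta /= shift_delta. Qed.
Let aop_dd f n j x : aop f (dd n j x) = dd n.+1 j (f x).
Proof. by rewrite [LHS]shift_delta /= pointwise_delta. Qed.
Let bop_dd f n j x : bop f (dd n j x) = dd n.+1 j.+1 (f x).
Proof. by rewrite [LHS]shift_delta /= shift_delta. Qed.

Let dd_linear n j : linear (dd n j).
Proof. by move=> a x y; rewrite /dd !linearP. Qed.
HB.instance Definition _ n j := GRing.isLinear.Build R E V2 *:%R (dd n j)
  (dd_linear n j).

Let dd_A n x : x \in A n -> dd n 0 x \in W0.
Proof.
have [A0 AS] := stdA; elim: n x => [|n IH] x.
  move=> /A0; apply: (generated_sub (U := submod_preimage (dd 0 0) W0)) => //.
  by move=> _ <-; exact: mem_generated.
move=> /AS; apply: (span_images_sub (W := submod_preimage (dd n.+1 0) W0)).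
move=> f fo y yA; suff: dd n.+1 0 (f y) \in W0 by [].
rewrite -aop_dd; apply: W0_stable (IH _ yA); exact: mem_aop.
Qed.

Let dd_B n x : x \in B n -> dd n n x \in W0.
Proof.
have [B0 BS] := stdB; elim: n x => [|n IH] x.
  move=> /B0; apply: (generated_sub (U := submod_preimage (dd 0 0) W0)) => //.
  by move=> _ <-; exact: mem_generated.
move=> /BS; apply: (span_images_sub (W := submod_preimage (dd n.+1 n.+1) W0)).
move=> f fo y yA; suff: dd n.+1 n.+1 (f y) \in W0 by [].
rewrite -bop_dd; apply: W0_stable (IH _ yA); exact: mem_bop.
Qed.

(** Both [top] and [bop] raise the exponent of [t], so only [aop] contributes to exponent 0. *)
Let W0_A f n : f \in W0 -> f n 0 \in A n.
Proof.
have P0 m : (0 : V2) m 0 \in A m by exact: rpred0.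
have PD a (g h : V2) : (forall m, g m 0 \in A m) -> (forall m, h m 0 \in A m) ->
    forall m, (a *: g + h) m 0 \in A m.
  by move=> gA hA m; apply: (rpredD (rpredZ a (gA m))).
move=> fW; move: n; apply/(submod_ofP P0 PD); move: f fW.
have [A0 AS] := stdA.
apply: generated_sub => [f fo g /submod_ofP gA|_ <-]; apply/submod_ofP.
  move: fo; rewrite inE mem_cat => /predU1P[->|/orP[]/mapP[h ho ->]] [|m] //=;
    rewrite ?rpred0 //.
  exact/AS/mem_span_images.
move=> [|m]; last exact: rpred0.
exact/A0/mem_generated.
Qed.

(** Multiplication by [t] is injective on sequences. *)
Let tW0_dd n j x : dd n j.+1 x \in tW0 -> dd n j x \in W0.
Proof.
move=> /asboolP[g gW gx]; suff <- : g = dd n j x by [].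
apply: funext => m; apply: funext => k.
have := congr1 (fun f : V2 => f m k.+1) gx.
rewrite /top /= /pointwise /= => ->.
by rewrite /dd /delta; case: eqP => // _; rewrite eqSS.
Qed.

Lemma finite_Ass_graded :
  finite_set [set p | exists n, Ass_quot (B n) (A n) p].
Proof.
have AB := standard_graded_sub stdA stdB aB.
apply: (@sub_finite_set _ _ (Ass_quot W0 tW0)); last first.
  apply: (@finite_Ass_quot _ _ ops) => //; first exact: noeth_generated1.
  by move=> _ /asboolP[x xW <-]; apply: W0_stable; rewrite ?mem_head.
move=> p [n [x xB px]].
pose P j := `[< exists2 r : R, r \notin p & dd n j (r *: x) \in W0 >].
have exP : exists j, P j.
  exists n; apply/asboolP; exists 1; first exact: prime_ideal_proper.
  by rewrite scale1r; exact: dd_B.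
(* The least exponent is not 0, since then [r *: x] would lie in [A n] and [r] in [p]. Its
   predecessor [j] is where minimality is applied. *)
have [[|j] /asboolP[r rp rxW] minj] := ex_minnP exP.
  have := W0_A n rxW; rewrite /dd !delta_eq => /px.
  by rewrite (negPf rp).
exists (dd n j.+1 (r *: x)) => // s; rewrite -linearZ; split=> [sp|/tW0_dd].
  have /dd_A sxW : s *: (r *: x) \in A n.
    by rewrite scalerA mulrC -scalerA rpredZ //; exact/px.
  apply/asboolP; exists (dd n j (s *: (r *: x))); last by rewrite top_dd.
  elim: j {minj rxW} => [//|j IH]; rewrite -top_dd.
  by apply: W0_stable => //; exact: mem_head.
rewrite scalerA => sW; apply: contrapT => /negP sp.
have := minj j; rewrite ltnn => /(_ _)/negP; apply => //.
by apply/asboolP; exists (s * r) => //; exact: prime_idealM_contra.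
Qed.

End Finiteness.

End Graded.

(** * Eventual constancy of the associated primes *)

Section Stability.
Variables (R : comPzRingType) (E : lmodType R).
Implicit Types (U W : submodule E) (p : Spec R).

Section Saturation.
Variables (p : Spec R) (U : submodule E).

Fact sat0 : exists2 r : R, r \notin p & r *: (0 : E) \in U.
Proof. by exists 1; [exact: prime_ideal_proper | rewrite scaler0 rpred0]. Qed.
Fact satD a x y : (exists2 r : R, r \notin p & r *: x \in U) ->
  (exists2 r : R, r \notin p & r *: y \in U) ->
  exists2 r : R, r \notin p & r *: (a *: x + y) \in U.
Proof.
move=> [r rp rx] [s sp sy]; exists (r * s); first exact: prime_idealM_contra.
rewrite scalerDr; apply: rpredD; last by rewrite -scalerA rpredZ.
by rewrite scalerA -mulrA mulrC -scalerA rpredZ.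
Qed.
(* The kernel of E -> (E / U)_p. *)
Definition sat : submodule E := submod_of sat0 satD.

Lemma satP x : x \in sat <-> exists2 r : R, r \notin p & r *: x \in U.
Proof. exact: submod_ofP. Qed.

Lemma sat_scale r x : r \notin p -> r *: x \in sat -> x \in sat.
Proof.
move=> rp /satP[s sp srx]; apply/satP; exists (s * r); last by rewrite -scalerA.
exact: prime_idealM_contra.
Qed.
End Saturation.

Section Transporter.
Variables (p : Spec R) (U W : submodule E).

Fact transporter0 : (0 : E) \in W /\ forall r : R, r \in p -> r *: (0 : E) \in U.
Proof. by split=> [|r _]; rewrite ?scaler0 rpred0. Qed.
Fact transporterD a x y :
  x \in W /\ (forall r : R, r \in p -> r *: x \in U) ->
  y \in W /\ (forall r : R, r \in p -> r *: y \in U) ->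
  a *: x + y \in W /\ (forall r : R, r \in p -> r *: (a *: x + y) \in U).
Proof.
move=> [xW xU] [yW yU]; split=> [|r rp]; first by rewrite rpredD ?rpredZ.
rewrite scalerDr; apply: rpredD; last exact: yU.
by rewrite scalerA mulrC -scalerA; apply: rpredZ; exact: xU.
Qed.
Definition transporter : submodule E := submod_of transporter0 transporterD.

Lemma transporterP x : x \in transporter <->
  x \in W /\ forall r : R, r \in p -> r *: x \in U.
Proof. exact: submod_ofP. Qed.

(** An element of the transporter has annihilator modulo [U] containing [p]; it is exactly [p] when
    no scalar outside [p] carries the element into [U]. *)
Lemma Ass_quotE :
  Ass_quot W U p <-> ~ {subset transporter <= sat p U}.
Proof.
split=> [[x xW px] /(_ x) tU|ntU].
  have /tU/satP[r rp /px] : x \in transporter.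
    by apply/transporterP; split=> // r /px.
  by rewrite (negPf rp).
apply: contrapT => nAss; apply: ntU => x /transporterP[xW px].
apply: contrapT => xU; apply: nAss; exists x => // r; split=> [/px //|rx].
by apply: contrapT => /negP rp; apply: xU; apply/satP; exists r.
Qed.
End Transporter.

Section Killed.
Variables (s : seq R) (U : submodule E).
Fact killed0 : (0 : E) \in U /\ forall r : R, r \in s -> r *: (0 : E) = 0.
Proof. by split=> [|r _]; rewrite ?rpred0 ?scaler0. Qed.
Fact killedD a x y :
  x \in U /\ (forall r : R, r \in s -> r *: x = 0) ->
  y \in U /\ (forall r : R, r \in s -> r *: y = 0) ->
  a *: x + y \in U /\ (forall r : R, r \in s -> r *: (a *: x + y) = 0).
Proof.
move=> [xU xs] [yU ys]; split=> [|r rs]; first by rewrite rpredD ?rpredZ.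
by rewrite scalerDr ys // scalerA mulrC -scalerA xs // scaler0 addr0.
Qed.
Definition killed : submodule E := submod_of killed0 killedD.

Lemma killedP x : x \in killed <-> x \in U /\ forall r : R, r \in s -> r *: x = 0.
Proof. exact: submod_ofP. Qed.
End Killed.

Variables (e : E) (aops bops : seq {linear E -> E}) (A B : nat -> submodule E).
Hypotheses (nR : noetherian R) (comm : commuting (aops ++ bops)).
Hypotheses (stdA : standard_graded e aops A) (stdB : standard_graded e bops B).
Hypothesis aB : graded_stable aops B.

Let commA : commuting aops.
Proof. by move=> f g fo go; apply: comm; rewrite mem_cat ?fo ?go. Qed.
Let commB : commuting bops.
Proof. by move=> f g fo go; apply: comm; rewrite mem_cat ?fo ?go orbT. Qed.

(* Multiplication by r embeds D / (0 :_D r) into A as a graded A-submodule, so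
   this quotient is finitely generated over A; repeating this for the elements
   of s shows that D / (0 :_D s) is finitely generated. *)
Lemma mod_killed_finite (s : seq R) (D : nat -> submodule E) :
    graded_stable aops D ->
    (forall n (r : R), r \in s -> forall x, x \in D n -> r *: x \in A n) ->
  exists N, forall n, (N <= n)%N -> {subset D n.+1 <=
    submod_add (span_images aops (D n)) (killed s (D n.+1))}.
Proof.
elim: s D => [|r s IH] D oD DA.
  exists 0 => n _ x xD; apply/submod_addP; exists 0, x; rewrite rpred0 add0r.
  by split=> //; apply/killedP.
have P0 n : exists2 x, x \in D n & (0 : E) = r *: x.
  by exists 0; rewrite ?rpred0 ?scaler0.
have PD n a y z : (exists2 x, x \in D n & y = r *: x) ->
    (exists2 x, x \in D n & z = r *: x) ->
    exists2 x, x \in D n & a *: y + z = r *: x.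
  move=> [x xD ->] [x' xD' ->]; exists (a *: x + x').
    by rewrite rpredD ?rpredZ.
  by rewrite scalerDr !scalerA mulrC.
pose X n := submod_of (P0 n) (@PD n).
have XP n x : x \in X n <-> exists2 y, y \in D n & x = r *: y by exact: submod_ofP.
have [|n f fo x /XP[y yD ->]|N1 hN1] := graded_noetherian nR commA stdA (X := X).
- by move=> n _ /XP[y yD ->]; apply: DA => //; exact: mem_head.
- by apply/XP; exists (f y); [exact: oD | rewrite linearZ].
have [n f fo x /killedP[xD xr]|n r' rs x /killedP[xD _]|N2 hN2] :=
  IH (fun n => killed [:: r] (D n)).
- apply/killedP; split=> [|r' /xr rx]; first exact: oD.
  by rewrite -linearZ rx raddf0.
- by apply: DA => //; rewrite inE rs orbT.
exists (maxn N1 N2) => n; rewrite geq_max => /andP[Nn1 Nn2] x xD.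
have spanD U : {subset U <= D n} -> {subset span_images aops U <= D n.+1}.
  by move=> UD; apply: span_images_sub => f fo z /UD; exact: oD.
(* Finite generation of [r D], lifted to [D], determines [x] up to an element killed by [r], to
   which the induction hypothesis applies. *)
have [y yS rxy] : exists2 y, y \in span_images aops (D n) & r *: x = r *: y.
  have : r *: x \in X n.+1 by apply/XP; exists x.
  move=> /(hN1 n Nn1) xX.
  have Q0 : exists2 y, y \in span_images aops (D n) & (0 : E) = r *: y.
    by exists 0; rewrite ?rpred0 ?scaler0.
  have QD a z z' : (exists2 y, y \in span_images aops (D n) & z = r *: y) ->
      (exists2 y, y \in span_images aops (D n) & z' = r *: y) ->
      exists2 y, y \in span_images aops (D n) & a *: z + z' = r *: y.
    move=> [y yS ->] [y' yS' ->]; exists (a *: y + y').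
      by rewrite rpredD ?rpredZ.
    by rewrite scalerDr !scalerA mulrC.
  apply/(submod_ofP Q0 QD); move: (r *: x) xX.
  apply: span_images_sub => f fo _ /XP[z zD ->]; apply/submod_ofP.
  by exists (f z); [exact: mem_span_images | rewrite linearZ].
have /(hN2 n Nn2)/submod_addP[u [v [uS /killedP[/killedP[vD vr] vs] xE]]] :
    x - y \in killed [:: r] (D n.+1).
  apply/killedP; split; first by rewrite rpredB // (spanD (D n)).
  by move=> r'; rewrite inE => /eqP ->; rewrite scalerBr rxy subrr.
apply/submod_addP; exists (y + u), v; split.
- apply: rpredD => //; move: u uS {xE}; apply: span_images_sub => f fo z.
  by move=> /killedP[zD _]; exact: mem_span_images.
- apply/killedP; split=> // r'; rewrite inE => /predU1P[->|/vs //].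
  by apply: vr; rewrite mem_head.
- by rewrite -addrA -xE addrC subrK.
Qed.

(* With C_n = (A_n : p) and T_n = (0 : p) in B_n, for large n one has
   C_{n+1} = A_1 C_n + T_{n+1}, T_{n+1} = B_1 T_n, and A_1 (A_n & T_n) is the
   intersection of A_{n+1} and T_{n+1}.  If C_n vanishes in (B_n / A_n)_p, then
   T_{n+1} is locally B_1 (A_n & T_n) = A_1 B_1 (A_{n-1} & T_{n-1}), contained in
   A_1 T_n, so C_{n+1} vanishes in (B_{n+1} / A_{n+1})_p. *)
Lemma eventually_not_Ass p : exists N, forall n, (N <= n)%N ->
  ~ Ass_quot (B n) (A n) p -> ~ Ass_quot (B n.+1) (A n.+1) p.
Proof.
have [s sp ps] := noetherian_ideal p nR.
pose C n := transporter p (A n) (B n).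
pose T n := killed s (B n).
have oA := standard_graded_stable stdA.
have oB := standard_graded_stable stdB.
have AB := standard_graded_sub stdA stdB aB.
have oT (ops : seq {linear E -> E}) : graded_stable ops B -> graded_stable ops T.
  move=> oB' n f fo x /killedP[xB xs]; apply/killedP; split; first exact: oB'.
  by move=> r /xs rx; rewrite -linearZ rx raddf0.
have oC : graded_stable aops C.
  move=> n f fo x /transporterP[xB px]; apply/transporterP; split; first exact: aB.
  by move=> r /px rx; rewrite -linearZ; exact: oA.
have TC n : {subset T n <= C n}.
  move=> x /killedP[xB xs]; apply/transporterP; split=> // r /ps[c ->].
  rewrite scaler_suml rpred_sum // => i _.
  by rewrite -scalerA xs ?mem_nth // scaler0 rpred0.
have [n r rs x /transporterP[_ px]|N1 hN1] := mod_killed_finite oC (s := s).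
  exact/px/sp.
have [n x /killedP[] //||N2 hN2] := graded_noetherian nR commB stdB (X := T).
  exact: oT.
have [n x /submod_capP[] //|n f fo x /submod_capP[xA xT]|N3 hN3] :=
    graded_noetherian nR commA stdA (X := fun n => submod_cap (A n) (T n)).
  by apply/submod_capP; split; [exact: oA | exact: (oT _ aB)].
exists (maxn N1 (maxn N2 N3.+1)) => n; rewrite !geq_max => /and3P[Nn1 Nn2 Nn3].
(* [hN3] is used one degree lower than the others, hence the bound [N3.+1] and the renaming of the
   degree to [n.+1]. *)
case: n Nn3 Nn1 Nn2 => // n Nn3 Nn1 Nn2.
move=> /Ass_quotE /contrapT Cn /Ass_quotE; apply.
have sat_step : {subset span_images aops (sat p (A n.+1)) <= sat p (A n.+2)}.
  apply: span_images_sub => f fo y /satP[r rp rx]; apply/satP; exists r => //.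
  by rewrite -linearZ; exact: oA.
have sat_mono (U : submodule E) : {subset U <= sat p (A n.+1)} ->
    {subset span_images aops U <= sat p (A n.+2)}.
  move=> US x xU; apply: sat_step; move: x xU.
  by apply: span_images_sub => f fo x /US; exact: mem_span_images.
have killedCT : {subset killed s (C n.+2) <= T n.+2}.
  by move=> x /killedP[/transporterP[xB _] xs]; apply/killedP.
move=> x /(hN1 _ Nn1)/submod_addP[u [v [uC /killedCT vT ->]]].
apply: rpredD; first exact: (sat_mono (C n.+1)).
have := hN2 _ Nn2 _ vT; move: v {vT}.
apply: span_images_sub => f fo y yT.
have /satP[r rp ryA] := Cn _ (TC _ _ yT).
apply: (sat_scale rp); rewrite -linearZ.
have : r *: y \in submod_cap (A n.+1) (T n.+1).
  by apply/submod_capP; split=> //; exact: rpredZ.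
move=> /(hN3 _ Nn3).
apply: (span_images_sub (W := submod_preimage f (sat p (A n.+2)))) => g go z.
move=> /submod_capP[_ zT]; suff: f (g z) \in sat p (A n.+2) by [].
(* After the exchange, [f] sends [z] into [T n.+1], which vanishes locally modulo [A n.+1], and [g],
   being an operator of A, preserves this. *)
rewrite comm ?mem_cat ?go ?fo ?orbT //.
apply: (sat_mono (T n.+1)); first by move=> w /TC/Cn.
by apply: mem_span_images => //; exact: (oT _ oB).
Qed.

(** Beyond the bound of [eventually_not_Ass], either [p] is always associated, or it fails once and
    then forever. *)
Lemma eventually_constant_Ass p : exists N, forall n, (N <= n)%N ->
  Ass_quot (B N) (A N) p <-> Ass_quot (B n) (A n) p.
Proof.
have [N hN] := eventually_not_Ass p.
have [[n Nn nA]|allA] :=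
  pselect (exists2 n, (N <= n)%N & ~ Ass_quot (B n) (A n) p); last first.
  have {}allA n : (N <= n)%N -> Ass_quot (B n) (A n) p.
    by move=> Nn; apply: contrapT => nA; apply: allA; exists n.
  by exists N => n Nn; split=> _; exact: allA.
have never m : ~ Ass_quot (B (m + n)) (A (m + n)) p.
  elim: m => // m; rewrite addSn; apply: hN.
  by rewrite (leq_trans Nn) // leq_addl.
exists n => m nm; split=> h; first by case: nA.
by move: (h); rewrite -(subnK nm) => /never.
Qed.

(** Only finitely many primes occur in any degree, so the maximum of their individual bounds serves
    for all. *)
Theorem graded_Ass_stable : exists N, forall n, (N <= n)%N ->
  Ass_quot (B n) (A n) = Ass_quot (B N) (A N).
Proof.
have /finite_seqP[s sE] := finite_Ass_graded nR comm stdA stdB aB.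
have [N hN] : exists N, forall p, p \in s -> forall n, (N <= n)%N ->
    Ass_quot (B N) (A N) p <-> Ass_quot (B n) (A n) p.
  elim: s {sE} => [|q s [N hN]]; first by exists 0.
  have [N' hN'] := eventually_constant_Ass q.
  exists (maxn N N') => p ps n; rewrite geq_max => /andP[Nn N'n].
  move: ps; rewrite inE => /predU1P[->|ps].
    by rewrite -(hN' n N'n) -(hN' _ (leq_maxr N N')).
  by rewrite -(hN p ps n Nn) -(hN p ps _ (leq_maxl N N')).
exists N => n Nn; apply/seteqP.
have mem_s m p : Ass_quot (B m) (A m) p -> p \in s.
  by move=> mp; suff: [set` s] p by []; rewrite -sE; exists m.
by split=> p pA; apply/(hN p (mem_s _ _ pA) n Nn).
Qed.

End Stability.

(** * Components of the Rees algebra as standard graded algebras *)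

Section ReesStandardGraded.
Variables (R : comPzRingType) (N : lmodType R).

Lemma rees_scalerAr (r : R) (x y : Rees N) : x * (r *: y) = r *: (x * y).
Proof.
rewrite -[x]rees_piK -[y]rees_piK -linearZ -!rmorphM -linearZ; congr rees_pi.
by rewrite !sym_scaleE mulrCA.
Qed.

Lemma rees_scalerAl (r : R) (x y : Rees N) : (r *: x) * y = r *: (x * y).
Proof. by rewrite mulrC rees_scalerAr mulrC. Qed.

Definition rees_gen (u : N) : Rees N := rees_pi (sym_inj u).
Fact rees_gen_linear : linear rees_gen.
Proof. by move=> a u v; rewrite /rees_gen !linearP. Qed.
HB.instance Definition _ :=
  GRing.isLinear.Build R N (Rees N) *:%R rees_gen rees_gen_linear.

Definition mul_gen (u : N) (x : Rees N) : Rees N := rees_gen u * x.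
Fact mul_gen_linear u : linear (mul_gen u).
Proof. by move=> a x y; rewrite /mul_gen mulrDr rees_scalerAr. Qed.
HB.instance Definition _ u :=
  GRing.isLinear.Build R (Rees N) (Rees N) *:%R (mul_gen u) (mul_gen_linear u).

Lemma mul_gen_comm u v x : mul_gen u (mul_gen v x) = mul_gen v (mul_gen u x).
Proof. exact: mulrCA. Qed.

Section Image.
Variables (L : lmodType R) (h : {linear L -> N}).

(** The identity of [N] in place of [h] gives the components of the Rees algebra, and the inclusion
    of [M] gives their subalgebra, so both are treated at once. *)
Definition rees_products (n : nat) (x : Rees N) : Prop :=
  exists s : seq (R * n.-tuple L),
    x = \sum_(c <- s) c.1 *: \prod_(u <- c.2) rees_gen (h u).

Lemma rees_products_mul n u x :
  rees_products n x -> rees_products n.+1 (mul_gen (h u) x).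
Proof.
move=> [s ->]; exists [seq (c.1, cons_tuple u c.2) | c <- s].
rewrite big_map raddf_sum; apply: eq_bigr => c _ /=.
by rewrite linearZ /= big_cons.
Qed.

(** By linearity the first factor of a product can be expanded in the finite list of generators. *)
Lemma rees_products_standard (s : seq L) (A : nat -> submodule (Rees N)) :
    (forall x : L, exists c : nat -> R, x = \sum_(i < size s) c i *: s`_i) ->
    (forall n x, x \in A n <-> rees_products n x) ->
  standard_graded (1 : Rees N)
    [seq (mul_gen (h u) : {linear Rees N -> Rees N}) | u <- s] A.
Proof.
move=> sP AP.
have gen_scale a y z : rees_gen (h (a *: y)) * z = a *: mul_gen (h y) z.
  by rewrite !linearZ rees_scalerAl.
split=> [x|n x]; split.
- move=> /AP[t ->]; apply: rpred_sum => c _; apply: rpredZ.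
  by rewrite [c.2]tuple0 big_nil; exact: mem_generated.
- apply: generated_sub => // _ <-; apply/AP.
  by exists [:: (1, [tuple])]; rewrite big_seq1 big_nil scale1r.
- move=> /AP[t ->]; apply: rpred_sum => c _; apply: rpredZ.
  case/tupleP: c.2 => u v; rewrite big_cons; have [d ->] := sP u.
  rewrite !raddf_sum mulr_suml; apply: rpred_sum => i _.
  rewrite gen_scale; apply: rpredZ.
  apply: (mem_span_images (f := mul_gen (h s`_i))).
    by apply/mapP; exists s`_i => //; exact: mem_nth.
  by apply/AP; exists [:: (1, v)]; rewrite big_seq1 scale1r.
- apply: span_images_sub => _ /mapP[u _ ->] y /AP yA.
  exact/AP/rees_products_mul.
Qed.
End Image.

Lemma rees_componentP n x :
  x \in rees_component N n <-> rees_products idfun n x.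
Proof.
split=> [/asboolP[_ /asboolP[s ->] <-]|[s ->]].
  exists s; rewrite raddf_sum; apply: eq_bigr => c _.
  by rewrite /= linearZ rmorph_prod.
apply/asboolP; exists (\sum_(c <- s) c.1 *: \prod_(u <- c.2) sym_inj u).
  by apply/asboolP; exists s.
rewrite raddf_sum; apply: eq_bigr => c _.
by rewrite /= linearZ rmorph_prod.
Qed.

Lemma rees_image_componentP (M : lmodType R) (iota : {linear M -> N}) n x :
  x \in rees_image_component iota n <-> rees_products iota n x.
Proof.
have map_products (s : seq (R * n.-tuple M)) :
    rees_map iota (rees_pi (\sum_(c <- s) c.1 *: \prod_(u <- c.2) sym_inj u)) =
    \sum_(c <- s) c.1 *: \prod_(u <- c.2) rees_gen (iota u).
  rewrite rees_mapE !raddf_sum; apply: eq_bigr => c _.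
  rewrite /= !linearZ /= !rmorph_prod; congr (_ *: _); apply: eq_bigr => u _.
  by rewrite /= sym_map_inj.
split=> [/asboolP[_ /asboolP[_ /asboolP[s ->] <-] <-]|[s ->]].
  by exists s; exact: map_products.
rewrite -map_products; apply/asboolP; eexists; last by [].
by apply/asboolP; eexists; last by []; apply/asboolP; exists s.
Qed.

End ReesStandardGraded.

(** * Passage to the quotients of Rees components *)

Lemma Ass_subquotient (R : comPzRingType) (V : lmodType R) (A B : submodule V) :
  Ass (subquotient A B) = Ass_quot A B.
Proof.
have scale0E (u : submod_type A) (r : R) :
    r *: quotmod_pi (submod_preimage (@submod_val R V A) B) u = 0 <->
    r *: submod_val u \in B.
  rewrite -linearZ -(raddf0 (quotmod_pi _)) quotmod_eqP subr0.
  by rewrite -[_ \in submod_preimage _ _]/(submod_val (r *: u) \in B) linearZ.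
apply/seteqP; split=> p.
  move=> [x]; rewrite -[x]quotmod_piK; case: (repr x) => y yA px.
  by exists y => // r; rewrite px (scale0E (SubmodElt yA)).
move=> [y yA px]; exists (quotmod_pi _ (SubmodElt yA)) => r.
by rewrite px (scale0E (SubmodElt yA)).
Qed.

Theorem corollary7p4 (R : comPzRingType) (M N : lmodType R)
    (iota : {linear M -> N}) :
  noetherian R -> finitely_generated M -> finitely_generated N ->
  injective iota ->
  exists n0 : nat, (1 <= n0)%N /\
    forall k : nat,
      Ass (rees_quotient iota n0) = Ass (rees_quotient iota (n0 + k)).
Proof.
move=> nR [sM sMP] [sN sNP] _.
have stdA := rees_products_standard sMP (rees_image_componentP iota).
have stdB := rees_products_standard sNP (@rees_componentP R N).
have [||n0 hn0] := graded_Ass_stable nR _ stdA stdB _.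
- move=> f g; rewrite !mem_cat.
  by move=> /orP[]/mapP[u _ ->] /orP[]/mapP[v _ ->] x; exact: mul_gen_comm.
- move=> n _ /mapP[u _ ->] x /rees_componentP xB.
  exact/rees_componentP/(rees_products_mul (h := idfun)).
(* The successor ensures that the degree is at least 1. *)
exists n0.+1; split=> // k; rewrite /rees_quotient !Ass_subquotient.
by rewrite (hn0 n0.+1) // (hn0 (n0.+1 + k)%N) // addSn leqW // leq_addr.
Qed.
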